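(* Let $(\hbar_N)_{N\ge 1}$ be a sequence of positive real numbers with $\hbar_N=o(1)$ as $N\to\infty$. For each $N\ge 1$ let $a_1^{(N)}>\dots>a_N^{(N)}$ and $b_1^{(N)}>\dots>b_N^{(N)}$ be elements of the lattice $\hbar_N\mathbb{Z}$, let $\mathbf V_N,\mathbf W_N$ be the corresponding irreducible rational representations of $\mathrm{GL}_N(\mathbb{C})$, and let $A_N,B_N$ be the associated Biane--Perelomov--Popov matrices over $\mathcal{A}_N=\operatorname{End}\mathbf V_N\otimes\operatorname{End}\mathbf W_N$. Suppose that the limits $$s_k=\lim_{N\to\infty}\overline{\wp}_k(a_1^{(N)},\dots,a_N^{(N)})\quad\text{and}\quad t_k=\lim_{N\to\infty}\overline{\wp}_k(b_1^{(N)},\dots,b_N^{(N)})$$ exist for each $k\in\mathbb{N}^*$. Then, for any fixed $d\in\mathbb{N}^*$ and any functions $p,q\colon[d]\to\mathbb{N}$, $$\lim_{N\to\infty}\mathbb{E}\operatorname{tr}\big(A_N^{p(1)}B_N^{q(1)}\cdots A_N^{p(d)}B_N^{q(d)}\big)=\tau\big(A^{p(1)}B^{q(1)}\cdots A^{p(d)}B^{q(d)}\big),$$ where $A,B$ are freely independent random variables in a tracial noncommutative probability space $(\mathcal{A},\tau)$ with $\tau(A^k)=s_k$ and $\tau(B^k)=t_k$ for all $k\in\mathbb{N}^*$.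
   Context: Notation: $\mathbb{N}=\{0,1,2,\dots\}$, $\mathbb{N}^*=\{1,2,\dots\}$, $[d]=\{1,\dots,d\}$. Representations and configurations: a configuration $c_1>\dots>c_N$ in $\hbar_N\mathbb{Z}$ corresponds to the irreducible rational representation of $\mathrm{GL}_N(\mathbb{C})$ with highest weight $\lambda=(\lambda_1\ge\dots\ge\lambda_N)\in\mathbb{Z}^N$, where $c_i=\hbar_N(\lambda_i+N-i)$. $\mathbf V_N$ corresponds to $(a_i^{(N)})$ and $\mathbf W_N$ to $(b_i^{(N)})$; $\rho_N,\sigma_N$ denote the induced actions of the universal enveloping algebra $\mathcal{U}(\mathfrak{gl}_N(\mathbb{C}))$ on $\mathbf V_N,\mathbf W_N$, and $e_{ij}$ are the standard generators (matrix units). BPP matrices: $A_N$ and $B_N$ are the $N\times N$ matrices over $\mathcal{A}_N=\operatorname{End}\mathbf V_N\otimes\operatorname{End}\mathbf W_N$ with $(i,j)$ entries $(A_N)_{ij}=\rho_N(\hbar_N e_{ij})\otimes I_{\mathbf W_N}$ and $(B_N)_{ij}=I_{\mathbf V_N}\otimes\sigma_N(\hbar_N e_{ij})$. The expectation $\mathbb{E}\colon\mathcal{A}_N\to\mathbb{C}$ is $\mathbb{E}=\operatorname{tr}_{\mathbf V_N}\otimes\operatorname{tr}_{\mathbf W_N}$, the tensor product of the normalized traces. For an $N\times N$ matrix $M$ over $\mathcal{A}_N$, $\operatorname{Tr}M=\sum_iM_{ii}\in\mathcal{A}_N$ and $\operatorname{tr}=N^{-1}\operatorname{Tr}$. BPP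 power sums: $$\overline{\wp}_k(x_1,\dots,x_N)=\frac1N\sum_{i=1}^Nx_i^k\prod_{j\ne i}\Big(1-\frac{\hbar_N}{x_i-x_j}\Big).$$ A tracial noncommutative probability space $(\mathcal{A},\tau)$ is a unital associative $\mathbb{C}$-algebra with a unital linear functional $\tau$ satisfying $\tau(XY)=\tau(YX)$. Elements $A,B\in\mathcal{A}$ are freely independent if $\tau$ vanishes on every alternating product of elements $f(A)$, $g(B)$ ($f,g$ univariate polynomials) each of which has $\tau$-value $0$. *)

(* Defs.v *)
From HB Require Import structures.
From mathcomp Require Import all_boot all_order all_algebra.
From mathcomp Require Import all_classical all_reals all_analysis.
From mathcomp Require Import complex mxtens.
From mathcomp Require mpoly.
Set Implicit Arguments.
Unset Strict Implicit.
Unset Printing Implicit Defensive.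
Import Order.TTheory GRing.Theory Num.Theory.
Import numFieldNormedType.Exports.
Local Open Scope classical_set_scope.
Local Open Scope ring_scope.

(* The coordinate ring of GL_N is K[x_11, .., x_NN, 1 / det]; the values of a
   function outside the invertible matrices are irrelevant. *)
Definition regular_on_GL (K : fieldType) (N : nat) (f : 'M[K]_N -> K) : Prop :=
  exists (P : mpoly.mpoly (N * N) K) (r : nat),
    forall g : 'M[K]_N, g \in unitmx ->
      f g = mpoly.meval (fun k => mxvec g 0 k) P / \det g ^+ r.

(* GL_N acts on column vectors 'cV_(rep_dim V) by left multiplication. *)
Record rational_rep (K : fieldType) (N : nat) := RationalRep {
  rep_dim : nat ;
  rep_fun :> 'M[K]_N -> 'M[K]_rep_dim ;
  rep_fun1 : rep_fun 1%:M = 1%:M ;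
  rep_funM : forall g g' : 'M[K]_N, g \in unitmx -> g' \in unitmx ->
    rep_fun (g *m g') = rep_fun g *m rep_fun g' ;
  rep_fun_regular : forall k l, regular_on_GL (fun g => rep_fun g k l)
}.

Definition rep_irreducible (K : fieldType) (N : nat) (V : rational_rep K N) :
    Prop :=
  (0 < rep_dim V)%N /\
  forall U : {vspace 'cV[K]_(rep_dim V)},
    (forall g : 'M[K]_N, g \in unitmx ->
       forall v, v \in U -> V g *m v \in U) ->
    U = 0%VS \/ U = fullv.

(* A highest weight vector is an eigenvector of the Borel subgroup of
   upper-triangular matrices b, with character b |-> \prod_i b_ii ^ lam_i. *)
Definition has_highest_weight (K : fieldType) (N : nat) (V : rational_rep K N)
    (lam : 'I_N -> int) : Prop :=
  exists2 v : 'cV[K]_(rep_dim V), v != 0 &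
    forall b : 'M[K]_N, b \in unitmx -> is_trig_mx b^T ->
      V b *m v = (\prod_(i < N) b i i ^ lam i) *: v.

(* Indices start at 0, so that N - i (1 <= i <= N) becomes N - i.+1. *)
Definition config_of_weight (R : realType) (hbar : R) (N : nat)
    (lam : 'I_N -> int) (i : 'I_N) : R :=
  hbar * (lam i + (N - i.+1)%N%:Z)%:~R.

Definition corresponds_to (R : realType) (hbar : R) (N : nat) (c : 'I_N -> R)
    (V : rational_rep R[i] N) : Prop :=
  rep_irreducible V /\
  exists2 lam : 'I_N -> int,
    c =1 config_of_weight hbar lam & has_highest_weight V lam.

(* The action of gl_N, i.e. of degree-one elements of its enveloping algebra:
   the differential at the identity of the action of GL_N. *)
Definition lie_action (K : numFieldType) (N : nat) (V : rational_rep K N)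
    (X : 'M[K]_N) : 'M[K]_(rep_dim V) :=
  'D_X (V : 'M[K]_N -> 'M[K]_(rep_dim V)) 1%:M.

(* End V (x) End W, with S (x) T realized as the Kronecker product S *t T. *)
Definition end_tensor (K : fieldType) (N : nat) (V W : rational_rep K N) :=
  'M[K]_(rep_dim V * rep_dim W).

Definition bpp_matrix_l (K : numFieldType) (N : nat) (hbar : K)
    (V W : rational_rep K N) : 'M[end_tensor V W]_N :=
  \matrix_(i, j) ((hbar *: lie_action V (delta_mx i j)) *t 1%:M).

Definition bpp_matrix_r (K : numFieldType) (N : nat) (hbar : K)
    (V W : rational_rep K N) : 'M[end_tensor V W]_N :=
  \matrix_(i, j) (1%:M *t (hbar *: lie_action W (delta_mx i j))).

Definition normalized_trace (K : fieldType) (n : nat) (X : 'M[K]_n) : K :=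
  n%:R^-1 * \tr X.

(* The tensor product of the normalized traces on End V and End W; see
   bpp_expectation_tens, which determines it since pure tensors span. *)
Definition bpp_expectation (K : fieldType) (N : nat) (V W : rational_rep K N)
    (X : end_tensor V W) : K :=
  normalized_trace X.

Lemma bpp_expectation_tens (K : fieldType) (N : nat) (V W : rational_rep K N)
    (S : 'M[K]_(rep_dim V)) (T : 'M[K]_(rep_dim W)) :
  bpp_expectation (S *t T : end_tensor V W) =
  normalized_trace S * normalized_trace T.
Proof.
rewrite /bpp_expectation /normalized_trace natrM invfM mulrACA; congr (_ * _).
rewrite /mxtrace big_distrlr /= pair_big /=.
rewrite (reindex (@mxtens_index _ _)) /=; last first.
  by exists (@mxtens_unindex _ _) => i _;
    [exact: mxtens_indexK | exact: mxtens_unindexK].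
by apply: eq_bigr => -[i j] _; rewrite tensmxE.
Qed.

(* tr = N^-1 Tr, with values in the algebra of entries. *)
Definition amplified_trace (K : fieldType) (N : nat) (V W : rational_rep K N)
    (M : 'M[end_tensor V W]_N) : end_tensor V W :=
  N%:R^-1 *: \tr M.

Definition bpp_power_sum (F : fieldType) (hbar : F) (N k : nat)
    (x : 'I_N -> F) : F :=
  N%:R^-1 * \sum_(i < N)
    x i ^+ k * \prod_(j < N | j != i) (1 - hbar / (x i - x j)).

Definition tracial_state (K : fieldType) (AA : algType K)
    (tau : {scalar AA}) : Prop :=
  tau 1 = 1 /\ forall X Y : AA, tau (X * Y) = tau (Y * X).

(* A letter (true, f) stands for f(A), and (false, g) for g(B). *)
Definition letter_value (K : fieldType) (AA : algType K) (A B : AA)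
    (u : bool * {poly K}) : AA :=
  if u.1 then horner_alg A u.2 else horner_alg B u.2.

(* The empty product 1 must be excluded, since tau 1 = 1. *)
Definition freely_independent (K : fieldType) (AA : algType K)
    (tau : {scalar AA}) (A B : AA) : Prop :=
  forall w : seq (bool * {poly K}),
    w != [::] ->
    sorted (fun u v => u.1 != v.1) w ->
    (forall u, u \in w -> tau (letter_value A B u) = 0) ->
    tau (\prod_(u <- w) letter_value A B u) = 0.

(* Main.v *)
(* E tr is the tracial state of End (C^N (x) V (x) W), in which A_N and B_N are
   self-adjoint once V and W carry invariant inner products.  Hence a
   noncommutative Hoelder inequality bounds all mixed moments by those of A_N and
   B_N, which are the BPP power sums: Tr (A_N ^ k) acts on V as a scalar,
   computed on the highest weight vector.  For words W_1, W_2, ... in A_N, B_N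
   consider the joint moments of the partial traces tr W_i.
   - As E is tracial, E [(A_N)_ij, W_ji T] = 0; summing over i and j gives
       E sum_(W = U A U') (tr U * tr (A U') - tr (U A) * tr U') T = O(1 / N),
     which is the equation, with D the derivation such that
     D A = 1 (x) A - A (x) 1 and D B = 0, that (tau (x) tau) o D = 0 expresses
     in the limit; free independence satisfies it exactly.
   - Moving letters cyclically inside tr W_i costs O(hbar_N), because
     [A_1, A_2] = hbar_N (P A_2 - A_2 P) for the two copies of A_N acting on
     C^N (x) C^N (x) V (x) W, with P the flip.
   These relations determine the limits by induction: a word A .. B splits into
   pairs of shorter words, and powers of a single letter are scalars.
   Invariant inner products come from the Fischer product on polynomials in the
   entries of g, via v |-> det (g) ^ r (g v)_0. *)
Require Import Defs.
From HB Require Import structures.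
From mathcomp Require Import all_boot all_order all_algebra.
From mathcomp Require Import mxtens ring zify.
From mathcomp Require mpoly.
Set Implicit Arguments.
Unset Strict Implicit.
Unset Printing Implicit Defensive.
Import Order.TTheory GRing.Theory Num.Theory.
Local Open Scope ring_scope.

Local Notation "A ^H" := (map_mx Num.conj A^T) (at level 8, format "A ^H") : ring_scope.

(** * Tracial states with an involution *)

(** The hypotheses control each power sum separately, with no uniformity in the exponent, so they
    give no bound on operator norms. Hence a family counts as bounded when every dyadic Schatten
    moment is bounded, with a constant depending on the order, and an error counts as small when its
    trace against every bounded family is O(hbar). Products and partial traces must preserve
    boundedness; this is what the Hoelder inequality is for, and it is derived from Cauchy-Schwarz
    alone by looking at words of maximal trace. The partial trace of a mixed word is an operator,
    not a scalar, so the loop equation does not close on the moments of single words. The induction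
    therefore runs over expectations of products of partial traces, and it proves at once that these
    expectations converge and that their limits factorize. The rates are as stated because the loop
    equation carries a factor hbar on the left, from the bracket, while on the right the commutator
    of A_N with the other traces is itself O(hbar). The two cancel and leave the factor 1 / N, which
    is the difference between two traces and one. *)

Lemma cauchy_schwarz_sum (C : numFieldType) (I : finType) (z p q : I -> C) :
  (forall i, 0 <= p i) -> (forall i, 0 <= q i) ->
  (forall i, `|z i| ^+ 2 <= p i * q i) ->
  `|\sum_i z i| ^+ 2 <= (\sum_i p i) * (\sum_i q i).
Proof.
move=> p0 q0 zpq.
apply: (@le_trans _ _ ((\sum_i `|z i|) ^+ 2)).
  by rewrite ler_sqr ?nnegrE ?sumr_ge0 // ler_norm_sum.
(* Doubling symmetrizes both double sums in i and j, so that they compare term by term: 2 |z_i|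
   |z_j| <= p_i q_j + p_j q_i, which after squaring is the AM-GM inequality. No square root of [p]
   or [q] is taken. *)
rewrite -(ler_pM2l (ltr0Sn C 1)).
have -> : 2%:R * ((\sum_i p i) * (\sum_i q i)) =
    \sum_i \sum_j (p i * q j + p j * q i).
  rewrite mulr_natl mulr2n [X in _ + X]mulrC !big_distrlr /= -big_split /=.
  by apply: eq_bigr => i _; rewrite -big_split /=; apply: eq_bigr => j _; rewrite [q i * _]mulrC.
have -> : 2%:R * (\sum_i `|z i|) ^+ 2 = \sum_i \sum_j (`|z i| * `|z j| *+ 2).
  rewrite mulr_natl expr2 big_distrlr /= -sumrMnl; apply: eq_bigr => i _.
  by rewrite -sumrMnl.
apply: ler_sum => i _; apply: ler_sum => j _.
have pq0 : 0 <= p i * q j + p j * q i by rewrite addr_ge0 ?mulr_ge0.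
rewrite -ler_sqr ?nnegrE ?mulrn_wge0 ?mulr_ge0 //.
have : (`|z i| * `|z j|) ^+ 2 <= (p i * q j) * (p j * q i).
  rewrite exprMn; apply: le_trans (ler_pM _ _ (zpq i) (zpq j)) _; rewrite ?exprn_ge0 //.
  by rewrite mulrACA [q i * _]mulrC mulrACA lexx.
move=> h; rewrite -mulr_natl exprMn; apply: le_trans (ler_wpM2l _ h) _; first by rewrite exprn_ge0.
set u := p i * q j; set v := p j * q i.
rewrite -subr_ge0; have -> : (u + v) ^+ 2 - 2%:R ^+ 2 * (u * v) = (u - v) ^+ 2.
  by ring.
rewrite real_exprn_even_ge0 // realB // ger0_real // mulr_ge0 //.
Qed.

(* [st_iota] embeds the scalars: square matrices of unspecified size form a ring,
   but the library gives them no algebra structure. *)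
Record star_trace (C : numClosedFieldType) := StarTrace {
  st_car :> pzRingType;
  st_phi : {additive st_car -> C};
  st_star : {additive st_car -> st_car};
  st_iota : {rmorphism C -> st_car};
  phi1 : st_phi 1 = 1;
  phiC : forall x y, st_phi (x * y) = st_phi (y * x);
  phi_iota : forall c x, st_phi (st_iota c * x) = c * st_phi x;
  phi_ge0 : forall x, 0 <= st_phi (x * st_star x);
  phi_CS : forall x y, `|st_phi (x * y)| ^+ 2 <=
     st_phi (x * st_star x) * st_phi (st_star y * y);
  starM : forall x y, st_star (x * y) = st_star y * st_star x;
  starK : involutive st_star;
  iotaC : forall c x, st_iota c * x = x * st_iota c;
  star_iota : forall c, st_star (st_iota c) = st_iota c^*
}.

Section MatrixStarTrace.
Variables (C : numClosedFieldType) (S : star_trace C) (n : nat).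
Notation phi := (@st_phi C S).
Notation star := (@st_star C S).
Notation iota := (@st_iota C S).

Definition mat_phi (X : 'M[S]_n.+1) : C := n.+1%:R^-1 * \sum_i phi (X i i).
Definition mat_star (X : 'M[S]_n.+1) : 'M[S]_n.+1 := \matrix_(i, j) star (X j i).
Definition mat_iota (c : C) : 'M[S]_n.+1 := (iota c)%:M.

Fact mat_phi_additive : zmod_morphism mat_phi.
Proof.
move=> X Y; rewrite /mat_phi -mulrBr -sumrB; congr (_ * _).
by apply: eq_bigr => i _; rewrite !mxE raddfB.
Qed.
HB.instance Definition _ := GRing.isZmodMorphism.Build _ _ mat_phi mat_phi_additive.

Fact mat_star_additive : zmod_morphism mat_star.
Proof. by move=> X Y; apply/matrixP => i j; rewrite !mxE raddfB. Qed.
HB.instance Definition _ := GRing.isZmodMorphism.Build _ _ mat_star mat_star_additive.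

Fact mat_iota_additive : zmod_morphism mat_iota.
Proof. by move=> c d; rewrite /mat_iota rmorphB raddfB. Qed.
HB.instance Definition _ := GRing.isZmodMorphism.Build _ _ mat_iota mat_iota_additive.
Fact mat_iota_multiplicative : monoid_morphism mat_iota.
Proof.
by split=> [|c d]; rewrite /mat_iota ?rmorph1 // rmorphM scalar_mxM.
Qed.
HB.instance Definition _ := GRing.isMonoidMorphism.Build _ _ mat_iota mat_iota_multiplicative.

Lemma mat_phiE (X Y : 'M[S]_n.+1) :
  mat_phi (X * Y) = n.+1%:R^-1 * \sum_i \sum_j phi (X i j * Y j i).
Proof.
by congr (_ * _); apply: eq_bigr => i _; rewrite mxE raddf_sum.
Qed.

Lemma mat_phi1 : mat_phi 1 = 1.
Proof.
rewrite /mat_phi (eq_bigr (fun=> 1)) => [|i _]; last by rewrite mxE eqxx phi1.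
by rewrite sumr_const card_ord mulVf // pnatr_eq0.
Qed.

Lemma mat_phiC X Y : mat_phi (X * Y) = mat_phi (Y * X).
Proof.
rewrite !mat_phiE exchange_big /=; congr (_ * _).
by apply: eq_bigr => i _; apply: eq_bigr => j _; rewrite phiC.
Qed.

Lemma mat_iotaE c X i j : (mat_iota c * X) i j = iota c * X i j.
Proof.
have -> : mat_iota c * X = iota c *: X by exact: mul_scalar_mx.
by rewrite mxE.
Qed.

Lemma mat_phi_iota c X : mat_phi (mat_iota c * X) = c * mat_phi X.
Proof.
rewrite /mat_phi mulrCA [in RHS]big_distrr; congr (_ * _).
by apply: eq_bigr => i _; rewrite mat_iotaE phi_iota.
Qed.

Lemma mat_phi_star X :
  mat_phi (X * mat_star X) = n.+1%:R^-1 * \sum_(k : 'I_n.+1 * 'I_n.+1) phi (X k.1 k.2 * star (X k.1 k.2)).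
Proof.
rewrite mat_phiE pair_big /=; congr (_ * _); apply: eq_bigr => k _; by rewrite mxE.
Qed.

Lemma mat_phi_ge0 X : 0 <= mat_phi (X * mat_star X).
Proof. by rewrite mat_phi_star mulr_ge0 ?invr_ge0 ?ler0n // sumr_ge0 // => k _; apply: phi_ge0. Qed.

(** Cauchy-Schwarz is a field of [star_trace], so it passes to matrices entry by entry: the trace of
    a product is a sum over index pairs, to which [cauchy_schwarz_sum] applies. *)
Lemma mat_phi_CS X Y : `|mat_phi (X * Y)| ^+ 2 <=
  mat_phi (X * mat_star X) * mat_phi (mat_star Y * Y).
Proof.
rewrite mat_phi_star.
have -> : mat_phi (mat_star Y * Y) =
    n.+1%:R^-1 * \sum_(k : 'I_n.+1 * 'I_n.+1) phi (star (Y k.2 k.1) * Y k.2 k.1).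
  rewrite mat_phiE pair_big /=; congr (_ * _); apply: eq_bigr => k _; by rewrite mxE.
rewrite mat_phiE pair_big /= mulrACA normrM exprMn.
rewrite ger0_norm ?invr_ge0 ?ler0n // -expr2 ler_wpM2l ?exprn_ge0 ?invr_ge0 ?ler0n //.
apply: cauchy_schwarz_sum => k; last exact: phi_CS.
  exact: phi_ge0.
by rewrite -{2}[Y _ _]starK; apply: phi_ge0.
Qed.

Lemma mat_starM X Y : mat_star (X * Y) = mat_star Y * mat_star X.
Proof.
apply/matrixP => i j; rewrite !mxE raddf_sum; apply: eq_bigr => k _.
by rewrite !mxE starM.
Qed.

Lemma mat_starK : involutive mat_star.
Proof. by move=> X; apply/matrixP => i j; rewrite !mxE starK. Qed.

Lemma mat_iotaC c X : mat_iota c * X = X * mat_iota c.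
Proof.
apply/matrixP => i j; rewrite mat_iotaE mxE (bigD1 j) //= mxE eqxx mulr1n -iotaC.
rewrite big1 ?addr0 // => k /negPf kj; by rewrite mxE kj mulr0n mulr0.
Qed.

Lemma mat_star_iota c : mat_star (mat_iota c) = mat_iota c^*.
Proof.
apply/matrixP => i j; rewrite !mxE eq_sym.
by case: (i == j); rewrite ?mulr1n ?star_iota // !mulr0n raddf0.
Qed.

Definition mat_star_trace : star_trace C :=
  StarTrace mat_phi1 mat_phiC mat_phi_iota mat_phi_ge0 mat_phi_CS mat_starM
    mat_starK mat_iotaC mat_star_iota.
End MatrixStarTrace.

Lemma exprM_rotate (T : pzRingType) (x y : T) n :
  (x * y) ^+ n.+1 = x * (y * x) ^+ n * y.
Proof.
elim: n => [|n IHn]; first by rewrite expr1 expr0 mulr1.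
by rewrite exprS IHn exprS !mulrA.
Qed.

Section StarTraceTheory.
Variables (C : numClosedFieldType) (S : star_trace C).
Notation phi := (@st_phi C S).
Notation star := (@st_star C S).
Notation iota := (@st_iota C S).

Lemma star1 : star 1 = 1.
Proof. by rewrite -[LHS]mulr1 -[X in _ * X](starK 1) -starM mulr1 starK. Qed.

Lemma starX x n : star (x ^+ n) = star x ^+ n.
Proof.
by elim: n => [|n IHn]; rewrite ?expr0 ?star1 // exprS starM IHn -exprSr.
Qed.

(** The Schatten norm of exponent 2^(k+1), raised to that exponent so that no root appears.
    Exponents are dyadic because each use of Cauchy-Schwarz cuts a word into two halves. *)
Definition moment k (x : S) : C := phi ((x * star x) ^+ (2 ^ k)).

Lemma moment_ge0 k x : 0 <= moment k x.
Proof.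
rewrite /moment; case: k => [|k]; first by rewrite expn0 expr1 phi_ge0.
set y := x * star x; have ys : star y = y by rewrite starM starK.
by rewrite expnS mul2n -addnn exprD -{2}ys -starX phi_ge0.
Qed.

Lemma moment_star k x : moment k (star x) = moment k x.
Proof.
rewrite /moment starK; have : (0 < 2 ^ k)%N by rewrite expn_gt0.
by case: (2 ^ k)%N => // m _; rewrite exprM_rotate phiC mulrA -exprS.
Qed.

Section Hoelder.
Variables (I : finType) (x : I -> S) (inv : I -> I).
Hypotheses (invK : involutive inv) (x_inv : forall i, x (inv i) = star (x i)).

Definition word_prod (w : seq I) : S := \prod_(i <- w) x i.
Definition word_star (w : seq I) : seq I := rev (map inv w).
Definition alternation m i : seq I := flatten (nseq m [:: i; inv i]).

Lemma word_prod_cat v w : word_prod (v ++ w) = word_prod v * word_prod w.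
Proof. exact: big_cat. Qed.

Lemma word_prod_star w : word_prod (word_star w) = star (word_prod w).
Proof.
rewrite /word_star; elim: w => [|i w IHw]; first by rewrite /word_prod big_nil star1.
rewrite /= rev_cons -cats1 word_prod_cat IHw [word_prod (i :: w)]big_cons starM.
by rewrite [word_prod [:: _]]big_seq1 x_inv.
Qed.

Lemma word_star_alternation m i : word_star (alternation m i) = alternation m i.
Proof.
rewrite /word_star /alternation; elim: m => //= m IHm.
rewrite invK !rev_cons IHm -!cats1 -catA /=.
elim: m {IHm} => //= m IHm; by rewrite IHm.
Qed.

Lemma word_prod_alternation m i :
  word_prod (alternation m i) = (x i * star (x i)) ^+ m.
Proof.
elim: m => [|m IHm]; first by rewrite /word_prod big_nil.
by rewrite /alternation /= /word_prod !big_cons -/(word_prod _) IHm x_inv mulrA -exprS.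
Qed.

Lemma size_alternation m i : size (alternation m i) = (m * 2)%N.
Proof. by rewrite /alternation size_flatten /shape map_nseq sumn_nseq mulnC. Qed.

(* Among the words of length 2^(k+1), the modulus of the trace is maximal at an
   alternating word: by Cauchy-Schwarz, if [u ++ v] is a maximizer then so is
   [u* ++ u], and up to rotation this doubles the initial alternating run. *)
Section Maximizer.
Variables (k : nat) (M : C).
Hypothesis M_max : forall w, size w = (2 ^ k.+1)%N -> `|phi (word_prod w)| <= M.

(** With u = r s, Cauchy-Schwarz gives M^2 <= phi (u u') phi (v' v), primes denoting adjoints; both
    factors are at most M, so the first equals M. The word u u' = r s s' r' is then rotated to r' r
    s s', which brings r' r to the front: if r is a self-adjoint run, the run has doubled. *)
Lemma maximizer_fold r s v : size (r ++ s) = (2 ^ k)%N -> size v = (2 ^ k)%N ->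
  `|phi (word_prod (r ++ s ++ v))| = M ->
  `|phi (word_prod (word_star r ++ r ++ s ++ word_star s))| = M.
Proof.
set u := r ++ s => su sv; rewrite catA -/u => uvM.
have sstar w : size (word_star w) = size w by rewrite size_rev size_map.
have -> : phi (word_prod (word_star r ++ r ++ s ++ word_star s)) =
    phi (word_prod u * star (word_prod u)).
  by rewrite /u !word_prod_cat !word_prod_star starM phiC !mulrA.
have a0 := phi_ge0 (word_prod u).
rewrite ger0_norm //; apply/eqP; rewrite eq_le.
have aM : phi (word_prod u * star (word_prod u)) <= M.
  rewrite -(ger0_norm a0) -word_prod_star -word_prod_cat M_max //.
  by rewrite size_cat sstar su addnn -mul2n -expnS.
rewrite aM /=.
have bM : phi (star (word_prod v) * word_prod v) <= M.
  apply: le_trans (real_ler_norm _) _.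
    by rewrite realE -{2}[word_prod v]starK phi_ge0.
  rewrite -word_prod_star -word_prod_cat M_max //.
  by rewrite size_cat sstar sv addnn -mul2n -expnS.
have M0 : 0 <= M by rewrite -uvM.
have := phi_CS (word_prod u) (word_prod v); rewrite -word_prod_cat uvM => le.
have {}le := le_trans le (ler_wpM2l a0 bM).
move: M0; rewrite le0r => /orP[/eqP->//|M0]; by move: le; rewrite expr2 ler_pM2r.
Qed.

Lemma maximizer_alternating w : size w = (2 ^ k.+1)%N ->
  `|phi (word_prod w)| = M -> exists i, moment k (x i) = M.
Proof.
move=> sw wM.
have run j : (j <= k)%N -> exists i s,
    size (alternation (2 ^ j) i ++ s) = (2 ^ k.+1)%N /\
    `|phi (word_prod (alternation (2 ^ j) i ++ s))| = M.
  elim: j => [_|j IHj jk].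
    case: w sw wM => [|i w] /= sw wM; first by move: (expn_gt0 2 k.+1); rewrite -sw.
    have k0 : (0 < 2 ^ k)%N by rewrite expn_gt0.
    have sw' : size w = ((2 ^ k).-1 + 2 ^ k)%N by move: sw; rewrite expnS; lia.
    (* Folding at the single letter [i] produces [inv i] followed by [i], the shortest alternation,
       and it starts with [inv i]. *)
    exists (inv i), (take (2 ^ k).-1 w ++ word_star (take (2 ^ k).-1 w)).
    have stk : size (take (2 ^ k).-1 w) = (2 ^ k).-1 by rewrite size_take_min sw'; lia.
    split; first by rewrite /= !size_cat /= size_rev size_map stk expnS; lia.
    have /= := @maximizer_fold [:: i] (take (2 ^ k).-1 w) (drop (2 ^ k).-1 w).
    rewrite stk prednK // size_drop cat_take_drop sw' addKn /alternation /= invK.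
    by apply.
  have [i [s [si sM]]] := IHj (ltnW jk).
  set r := alternation _ _ in si sM.
  have sr : size r = (2 ^ j.+1)%N by rewrite size_alternation expnS mulnC.
  have le : (2 ^ j.+1 <= 2 ^ k)%N by rewrite leq_exp2l.
  set d := (2 ^ k - 2 ^ j.+1)%N.
  have ss : size s = (d + 2 ^ k)%N by move: si; rewrite size_cat sr /d [(2 ^ k.+1)%N]expnS; lia.
  have std : size (take d s) = d by rewrite size_take_min ss; lia.
  exists i, (take d s ++ word_star (take d s)).
  have rr : alternation (2 ^ j.+1) i = r ++ r.
    by rewrite /r /alternation -flatten_cat -nseqD addnn -mul2n -expnS.
  split.
    rewrite size_cat rr !size_cat sr size_rev size_map std /d [(2 ^ k.+1)%N]expnS.
    by move: le; lia.
  have := @maximizer_fold r (take d s) (drop d s).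
  rewrite size_cat sr std size_drop cat_take_drop ss addKn /d subnKC //.
  rewrite word_star_alternation rr -!catA; exact.
(* For j = k the run has length 2^(k+1) and fills the whole word. *)
have [i [s [si sM]]] := run k (leqnn k); exists i.
have s0 : s = [::].
  by apply/nilP; rewrite /nilp; move: si; rewrite size_cat size_alternation expnS; lia.
by rewrite -sM s0 cats0 word_prod_alternation ger0_norm // -/(moment _ _) moment_ge0.
Qed.
End Maximizer.

(** The bound is by the moment of the worst letter instead of a product of norms: there are finitely
    many words of the given length, and the one with the largest trace can be taken alternating. *)
Lemma hoelder k w : size w = (2 ^ k.+1)%N ->
  exists i, `|phi (word_prod w)| <= moment k (x i).
Proof.
move=> /eqP sw; pose F (t : (2 ^ k.+1).-tuple I) := `|phi (word_prod t)|.
pose t0 := Tuple sw.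
(* [C] is only partially ordered, so a maximum needs comparability of the values; moduli are real,
   hence comparable. *)
have [||t _ tmax] := @Order.POrderTheory.comparable_arg_maxP _ _ _ t0 predT F.
- by [].
- by move=> ? ? _ _; apply: real_comparable; rewrite normr_real.
have [|||i iM] := @maximizer_alternating k (F t) _ t.
- by move=> v /eqP sv; apply: (tmax (Tuple sv)).
- by rewrite size_tuple.
- by [].
by exists i; rewrite iM; apply: (tmax t0).
Qed.
End Hoelder.
End StarTraceTheory.

(** * Moment bounds *)

Section Moments.
Variables (C : numClosedFieldType) (S : star_trace C).
Notation phi := (@st_phi C S).

Definition pair_letter (x y : S) (u : bool * bool) : S :=
  let z := if u.1 then x else y in if u.2 then st_star S z else z.

Lemma hoelder2 (x y : S) k (w : seq (bool * bool)) : size w = (2 ^ k.+1)%N ->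
  `|phi (word_prod (pair_letter x y) w)| <= moment k x + moment k y.
Proof.
move=> sw.
have [||[b e]] := @hoelder C S _ (pair_letter x y) (fun u => (u.1, ~~ u.2)) _ _ k w sw.
- by move=> [b e] /=; rewrite negbK.
- by move=> [b []] //=; rewrite /pair_letter /= starK.
move=> le; apply: le_trans le _; rewrite /pair_letter /=.
by case: b; case: e; rewrite ?moment_star ?lerDl ?lerDr moment_ge0.
Qed.

Lemma word_prod_flatten (I : Type) (x : I -> S) m w :
  \prod_(i <- flatten (nseq m w)) x i = (\prod_(i <- w) x i) ^+ m.
Proof.
by elim: m => [|m IHm]; rewrite /= ?big_nil ?big_cat //= IHm exprS.
Qed.

(** The moment on the left is the trace of the word x, y, [star y], [star x] repeated 2^k times. Its
    length is 2^(k+2), twice that of the moments of order k, hence the order k+1 on the right. *)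
Lemma moment_mul_le k (x y : S) : moment k (x * y) <= moment k.+1 x + moment k.+1 y.
Proof.
pose w := [:: (true, false); (false, false); (false, true); (true, true)].
have -> : moment k (x * y) = phi (word_prod (pair_letter x y) (flatten (nseq (2 ^ k) w))).
  by rewrite /moment /word_prod word_prod_flatten !big_cons big_nil /pair_letter /= starM mulr1 !mulrA.
apply: le_trans (real_ler_norm _) (hoelder2 _ _ _).
  by rewrite realE -[X in 0 <= X](_ : moment k (x * y) = _) ?moment_ge0 //
   /moment /word_prod word_prod_flatten !big_cons big_nil /pair_letter /= starM mulr1 !mulrA.
by rewrite size_flatten /shape map_nseq sumn_nseq /= !expnS; lia.
Qed.

(** Cauchy-Schwarz against 1 bounds the square of |phi x|; the inequality r <= 1 + r^2 replaces the
    square root. *)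
Lemma norm_phi_le (x : S) : `|phi x| <= 1 + moment 0 x.
Proof.
have := phi_CS x 1; rewrite star1 !mulr1 phi1 mulr1 /moment expn0 expr1 => le.
have := normr_ge0 (phi x); set r := `|_| in le * => r0.
apply: le_trans (lerD (lexx 1) le).
rewrite -subr_ge0 (_ : _ - r = (r - 1 / 2%:R) ^+ 2 + (1 / 2%:R) ^+ 2 + 1 / 2%:R); last by field.
have sq : 0 <= (r - 1 / 2%:R) ^+ 2.
  by rewrite real_exprn_even_ge0 // realB ?ger0_real ?divr_ge0.
by rewrite addr_ge0 ?divr_ge0 // addr_ge0 // exprn_ge0 ?divr_ge0.
Qed.
End Moments.

Lemma moment_morph (C : numClosedFieldType) (S S' : star_trace C) (f : S -> S') :
  f 1 = 1 -> (forall x y, f (x * y) = f x * f y) ->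
  (forall x, f (st_star S x) = st_star S' (f x)) ->
  (forall x, st_phi S' (f x) = st_phi S x) ->
  forall k x, moment k (f x) = moment k x.
Proof.
move=> f1 fM fs fp k x; rewrite /moment -fs -fM -fp; congr (st_phi _ _); move: (x * _) => y.
by elim: (2 ^ k)%N => [|m IHm]; rewrite ?expr0 ?f1 // !exprS fM IHm.
Qed.

Section Embeddings.
Variables (C : numClosedFieldType) (S : star_trace C) (n : nat).
Local Notation Mat := (mat_star_trace S n).

Lemma star_scalar (x : S) : st_star Mat x%:M = (st_star S x)%:M :> 'M_n.+1.
Proof. by apply/matrixP => i j; rewrite !mxE eq_sym raddfMn. Qed.

Lemma phi_scalar (x : S) : st_phi Mat x%:M = st_phi S x.
Proof.
rewrite /= /mat_phi (eq_bigr (fun=> st_phi S x)) => [|i _]; last by rewrite mxE eqxx.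
by rewrite sumr_const card_ord -[st_phi S x *+ _]mulr_natl mulKf // pnatr_eq0.
Qed.

Lemma moment_scalar k (x : S) : moment k (x%:M : Mat) = moment k x.
Proof.
move: k x; apply: (@moment_morph C S Mat (fun x => x%:M)) => [||x|x] //.
- by move=> x y; rewrite scalar_mxM.
- by rewrite star_scalar.
- exact: phi_scalar.
Qed.

Definition ptr (X : Mat) : S := st_iota S n.+1%:R^-1 * \sum_i (X : 'M[S]_n.+1) i i.

Lemma phi_ptr X : st_phi S (ptr X) = st_phi Mat X.
Proof. by rewrite phi_iota raddf_sum. Qed.

Lemma mulmx_scalar (X : 'M[S]_n.+1) z i j : (X * z%:M) i j = X i j * z.
Proof.
rewrite mxE (bigD1 j) //= big1 ?addr0 ?mxE ?eqxx // => k /negPf kj.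
by rewrite mxE kj mulr0.
Qed.

Lemma scalar_mulmx (X : 'M[S]_n.+1) z i j : (z%:M * X) i j = z * X i j.
Proof.
have -> : z%:M * X = z *: X by exact: mul_scalar_mx.
by rewrite mxE.
Qed.

Lemma ptr_mul_scalar X z : ptr (X * (z%:M : 'M_n.+1)) = ptr X * z.
Proof.
rewrite /ptr -mulrA big_distrl; congr (_ * _); apply: eq_bigr => i _.
exact: mulmx_scalar.
Qed.

Lemma phi_ptr_mul X z : st_phi S (ptr X * z) = st_phi Mat (X * (z%:M : 'M_n.+1)).
Proof. by rewrite -ptr_mul_scalar phi_ptr. Qed.

(* The partial trace contracts moments: apply the maximum principle to a word
   containing [W + W] once and the adjoint and values of [ptr W] otherwise. *)
Lemma moment_ptr k X : moment k (ptr X) <= moment k (X + X).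
Proof.
set t := ptr X; set b := moment k t; set a := moment k (X + X).
have b0 : 0 <= b by exact: moment_ge0.
pose w := (true, false) :: (false, true) ::
  flatten (nseq (2 ^ k).-1 [:: (false, false); (false, true)]).
have sw : size w = (2 ^ k.+1)%N.
  rewrite /= size_flatten /shape map_nseq sumn_nseq /= expnS.
  by move: (expn_gt0 2 k) => /=; case: (2 ^ k)%N => //= m _; lia.
have := hoelder2 (X + X : Mat) (t%:M : Mat) sw.
rewrite moment_scalar -/a -/b.
have -> : st_phi Mat (word_prod (pair_letter (X + X : Mat) (t%:M : Mat)) w) = b + b.
  rewrite /word_prod !big_cons word_prod_flatten !big_cons big_nil mulr1 /pair_letter /=.
  rewrite -!/(st_star Mat _) star_scalar.
  have -> : (t%:M : Mat) * (st_star S t)%:M = (t * st_star S t)%:M by rewrite scalar_mxM.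
  have -> m (z : S) : (z%:M : Mat) ^+ m = (z ^+ m)%:M.
    by elim: m => // m IHm; rewrite !exprS scalar_mxM IHm.
  have -> (u v : S) : (u%:M : Mat) * v%:M = (u * v)%:M by rewrite scalar_mxM.
  rewrite mulrDl raddfD /= -!/(st_phi Mat _) -phi_ptr_mul -/t mulrA -exprS prednK ?expn_gt0 //.
(* The single letter [X + X] contributes a factor 2, so the Hoelder bound reads b + b <= a + b and
   one b cancels. *)
rewrite ger0_norm ?addr_ge0 //.
by rewrite lerD2r.
Qed.

End Embeddings.

(** * Two commuting copies of the matrix space, and the flip between them *)

Section TwoCopies.
Variables (C : numClosedFieldType) (S : star_trace C) (n : nat).
Local Notation Mat := (mat_star_trace S n).

(** The first copy of C^N is the outer matrix index and the second copy is the inner one; [flip] is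
    then the sum of the E_ij (x) E_ji. *)
Definition emb1 (X : Mat) : mat_star_trace Mat n :=
  \matrix_(i, j) (X i j)%:M.
Definition emb2 (X : Mat) : mat_star_trace Mat n := X%:M.

Lemma emb1M X Y : emb1 (X * Y) = emb1 X * emb1 Y.
Proof.
apply/matrixP => i j; rewrite !mxE raddf_sum; apply: eq_bigr => k _.
rewrite [emb1 X i k]mxE [emb1 Y k j]mxE. exact: scalar_mxM.
Qed.
Lemma emb2M X Y : emb2 (X * Y) = emb2 X * emb2 Y.
Proof. exact: scalar_mxM. Qed.

Lemma phi_emb1 X : st_phi (mat_star_trace Mat n) (emb1 X) = st_phi Mat X.
Proof.
by congr (_ * _); apply: eq_bigr => i _; rewrite mxE; apply: phi_scalar.
Qed.

Lemma moment_emb1 k X : moment k (emb1 X) = moment k X.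
Proof.
move: k X; apply: moment_morph.
- by apply/matrixP => i j; rewrite !mxE; case: eqP => // _; rewrite !raddf0.
- exact: emb1M.
- by move=> X; apply/matrixP => i j; rewrite !mxE -star_scalar.
- exact: phi_emb1.
Qed.

Lemma moment_emb2 k X : moment k (emb2 X) = moment k X.
Proof. exact: moment_scalar. Qed.

Definition flip : mat_star_trace Mat n := \matrix_(i, j) (delta_mx j i : 'M[S]_n.+1).

Lemma flip_star : st_star _ flip = flip.
Proof.
apply/matrixP => i j; apply/matrixP => k l; rewrite !mxE andbC.
by case: (_ && _); rewrite ?raddf0 ?star1.
Qed.

Lemma flip_sqr : flip * flip = 1.
Proof.
apply/matrixP => i j; rewrite mxE.
transitivity (\sum_m (delta_mx m i * delta_mx j m : 'M[S]_n.+1)).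
  by apply: eq_bigr => m _; rewrite !mxE.
apply/matrixP => k l; rewrite summxE.
transitivity (\sum_m ((k == m) && (l == m) && (i == j))%:R : S).
  apply: eq_bigr => m _; have -> : delta_mx m i * delta_mx j m = delta_mx m i *m delta_mx j m :> 'M[S]_n.+1 by [].
  by rewrite mul_delta_mx_cond mulmxnE mxE -mulrnA mulnb.
rewrite mxE; case: (i == j); last by rewrite !mxE big1 // => m _; rewrite andbF.
rewrite mxE (bigD1 k) //= big1 ?eqxx ?addr0 ?andbT => [|m /negPf km]; first by rewrite eq_sym.
by rewrite eq_sym km.
Qed.

Lemma moment_flip k : moment k flip = 1.
Proof. by rewrite /moment flip_star flip_sqr expr1n phi1. Qed.
End TwoCopies.

(** * Families with bounded moments, and errors of order hbar *)

Section Families.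
Variables (C : numClosedFieldType) (h : nat -> C).
Hypothesis h_gt0 : forall n, 0 < h n.

Definition bounded_moments (S : nat -> star_trace C) (x : forall n, S n) :=
  forall k, exists c : C, forall n, moment k (x n) <= c.

(** Smallness is tested weakly, by traces against bounded families. Such errors form a two-sided
    ideal over the bounded families, so the Leibniz rule propagates small commutators from letters
    to words. *)
Definition small (S : nat -> star_trace C) (e : forall n, S n) :=
  forall y : forall n, S n, bounded_moments y ->
  exists c : C, forall n, `|st_phi (S n) (y n * e n)| <= c * h n.

Section OneFamily.
Variable S : nat -> star_trace C.
Implicit Types x y e : forall n, S n.

Lemma bounded_mul x y : bounded_moments x -> bounded_moments y -> bounded_moments (fun n => x n * y n).
Proof.
move=> bx by_ k; have [c cx] := bx k.+1; have [d dy] := by_ k.+1.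
by exists (c + d) => n; apply: le_trans (moment_mul_le _ _ _) (lerD _ _).
Qed.

Lemma bounded_1 : bounded_moments (fun n => 1 : S n).
Proof. by move=> k; exists 1 => n; rewrite /moment star1 mulr1 expr1n phi1. Qed.

Lemma bounded_phi x : bounded_moments x -> exists c : C, forall n, `|st_phi (S n) (x n)| <= c.
Proof.
move=> /(_ 0%N) [c cx]; exists (1 + c) => n.
by apply: le_trans (norm_phi_le _) _; rewrite lerD2l.
Qed.

Lemma small_eq e e' : (forall n, e n = e' n) -> small e -> small e'.
Proof. by move=> ee' se y /se[c ce]; exists c => n; rewrite -ee'. Qed.

Lemma small0 : small (fun n => 0 : S n).
Proof. by move=> y _; exists 0 => n; rewrite mulr0 raddf0 normr0 mul0r. Qed.

Lemma small_add e e' : small e -> small e' -> small (fun n => e n + e' n).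
Proof.
move=> se se' y ybd; have [c ce] := se y ybd; have [d de] := se' y ybd.
exists (c + d) => n; rewrite mulrDr raddfD mulrDl.
exact: le_trans (ler_normD _ _) (lerD _ _).
Qed.

Lemma small_opp e : small e -> small (fun n => - e n).
Proof.
move=> se y /se[c ce]; exists c => n; rewrite mulrN raddfN. rewrite normrN. exact: ce.
Qed.

Lemma small_mull x e : bounded_moments x -> small e -> small (fun n => x n * e n).
Proof.
move=> bx se y ybd; have [c ce] := se _ (bounded_mul ybd bx).
by exists c => n; rewrite mulrA.
Qed.

Lemma small_mulr x e : bounded_moments x -> small e -> small (fun n => e n * x n).
Proof.
move=> bx se y ybd; have [c ce] := se _ (bounded_mul bx ybd).
by exists c => n; rewrite mulrA phiC mulrA.
Qed.

Lemma small_iota x : bounded_moments x -> small (fun n => st_iota (S n) (h n) * x n).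
Proof.
move=> bx y ybd; have [c ce] := bounded_phi (bounded_mul ybd bx); exists c => n.
rewrite mulrA -iotaC -mulrA phi_iota normrM mulrC (gtr0_norm (h_gt0 n)).
by rewrite ler_pM2r // ce.
Qed.

Definition commutator x y n : S n := x n * y n - y n * x n.

Lemma small_comm_sym x y : small (commutator x y) -> small (commutator y x).
Proof. by move=> /small_opp; apply: small_eq => n; rewrite opprB. Qed.

Lemma small_commMr x y z : bounded_moments y -> bounded_moments z ->
  small (commutator x y) -> small (commutator x z) ->
  small (commutator x (fun n => y n * z n)).
Proof.
move=> yb zb xy xz; have := small_add (small_mulr zb xy) (small_mull yb xz).
apply: small_eq => n; rewrite /commutator mulrBl mulrBr !mulrA.
by rewrite addrA subrK.
Qed.

Lemma small_comm1 x : small (commutator x (fun n => 1)).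
Proof. by apply: small_eq small0 => n; rewrite /commutator mulr1 mul1r subrr. Qed.

Lemma bounded_eq x y : (forall n, x n = y n) -> bounded_moments x -> bounded_moments y.
Proof. by move=> xy bx k; have [c cx] := bx k; exists c => n; rewrite -xy. Qed.

Lemma bounded_prod (I : Type) (w : seq I) (y : I -> forall n, S n) :
  (forall i, bounded_moments (y i)) -> bounded_moments (fun n => \prod_(i <- w) y i n).
Proof.
move=> yb; elim: w => [|i w IHw].
  by apply: bounded_eq bounded_1 => n; rewrite big_nil.
by apply: bounded_eq (bounded_mul (yb i) IHw) => n; rewrite big_cons.
Qed.

Lemma small_comm_prod x (I : Type) (w : seq I) (y : I -> forall n, S n) :
  (forall i, bounded_moments (y i)) -> (forall i, small (commutator x (y i))) ->
  small (commutator x (fun n => \prod_(i <- w) y i n)).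
Proof.
move=> yb xy; elim: w => [|i w IHw].
  by apply: small_eq (small_comm1 x) => n; rewrite /commutator big_nil.
apply: small_eq (small_commMr (yb i) (bounded_prod w yb) (xy i) IHw) => n.
by rewrite /commutator big_cons.
Qed.
End OneFamily.

Section MatrixModels.
Variables (S : nat -> star_trace C) (d : nat -> nat).
Let M n := mat_star_trace (S n) (d n).
Let M2 n := mat_star_trace (M n) (d n).

Lemma bounded_ptr (x : forall n, M n) : bounded_moments x -> bounded_moments (fun n => ptr (x n)).
Proof.
move=> bx k; have [c cx] : exists c, forall n, moment k (x n + x n) <= c.
  have twob : bounded_moments (fun n => 1 + 1 : M n).
    move=> j; exists (2 ^+ (2 ^ j.+1)) => n.
    have -> : (1 + 1 : M n) = st_iota (M n) 2%:R by rewrite rmorph_nat.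
    rewrite /moment star_iota -rmorphM -rmorphXn -[st_iota _ _]mulr1 phi_iota phi1 mulr1.
    by rewrite conjC_nat -expr2 -exprM expnS.
  have [c cx] := bounded_mul twob bx k.
  by exists c => n; have := cx n; rewrite mulrDl mul1r.
by exists c => n; apply: le_trans (moment_ptr _ _) (cx n).
Qed.

Lemma bounded_scalar (x : forall n, S n) : bounded_moments x -> bounded_moments (fun n => (x n)%:M : M n).
Proof. by move=> bx k; have [c cx] := bx k; exists c => n; rewrite moment_scalar; apply: cx. Qed.

Lemma bounded_emb1 (x : forall n, M n) : bounded_moments x -> @bounded_moments M2 (fun n => emb1 (x n)).
Proof. by move=> bx k; have [c cx] := bx k; exists c => n; rewrite moment_emb1; apply: cx. Qed.

Lemma bounded_emb2 (x : forall n, M n) : bounded_moments x -> @bounded_moments M2 (fun n => emb2 (x n)).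
Proof. by move=> bx k; have [c cx] := bx k; exists c => n; rewrite moment_emb2; apply: cx. Qed.

Lemma bounded_flip : @bounded_moments M2 (fun n => flip (S n) (d n)).
Proof. by move=> k; exists 1 => n; rewrite moment_flip. Qed.

Lemma phi_emb12 n (z y : M n) :
  st_phi (M n) (z * ((ptr y)%:M : M n)) = st_phi (M2 n) (emb1 z * emb2 y).
Proof.
rewrite /= /mat_phi -!/(st_phi _ _); congr (_ * _); apply: eq_bigr => i _.
rewrite mulmx_scalar phiC phi_ptr_mul phiC.
by congr (st_phi _ _); rewrite [RHS]mulmx_scalar mxE.
Qed.

(* Tracing out the second copy turns [[X_1, Y_2]] into [[X, tr Y]]. *)
Lemma small_comm_ptr (x y : forall n, M n) :
  @small M2 (commutator (fun n => emb1 (x n)) (fun n => emb2 (y n))) ->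
  small (commutator x (fun n => (ptr (y n))%:M : M n)).
Proof.
move=> se z zb; have [c ce] := se _ (bounded_emb1 zb); exists c => n.
suff -> : st_phi (M n) (z n * commutator x (fun n => (ptr (y n))%:M : M n) n) =
  st_phi (M2 n) (emb1 (z n) * commutator (fun n => emb1 (x n)) (fun n => emb2 (y n)) n) by [].
rewrite /commutator !mulrBr !raddfB; congr (_ - _).
  by rewrite !mulrA -emb1M phi_emb12.
by rewrite !mulrA phiC [RHS]phiC !mulrA -emb1M phi_emb12.
Qed.
End MatrixModels.
End Families.

(** * The loop equation *)

Definition word_value (T : pzRingType) (X : bool -> T) (w : seq bool) : T :=
  \prod_(b <- w) X b.

Lemma word_value_cat (T : pzRingType) (X : bool -> T) v w :
  word_value X (v ++ w) = word_value X v * word_value X w.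
Proof. exact: big_cat. Qed.

Lemma word_value_nseq (T : pzRingType) (X : bool -> T) k b :
  word_value X (nseq k b) = X b ^+ k.
Proof. by rewrite /word_value big_nseq -Monoid.iteropE; elim: k => //= k ->; rewrite exprS. Qed.

Lemma iota_mulmx (C : numClosedFieldType) (S : star_trace C) n c
    (Y : mat_star_trace S n) i j :
  (st_iota (mat_star_trace S n) c * Y) i j = st_iota S c * Y i j.
Proof. exact: mat_iotaE. Qed.

Section Bracket.
Variables (C : numClosedFieldType) (S : star_trace C) (n : nat) (h : C).
Notation Mat := (mat_star_trace S n).
Notation iota_ := (st_iota S).

(** The letter [true] stands for A_N and [false] for B_N: each satisfies the relations of gl_N
    rescaled by [h], and their entries commute with one another. *)
Definition gl_bracket (X : bool -> 'M[S]_n.+1) :=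
  forall b c i j k l, X b i j * X c k l - X c k l * X b i j =
    if b == c then iota_ h * ((if j == k then X b i l else 0) -
                              (if i == l then X b k j else 0)) else 0.

Variable X : bool -> 'M[S]_n.+1.
Hypothesis XX : gl_bracket X.

Lemma delta_mxM i j (Y : 'M[S]_n.+1) k l :
  (delta_mx i j * Y) k l = if k == i then Y j l else 0.
Proof.
rewrite mxE (bigD1 j) //= big1 ?addr0 => [|m /negPf mj].
  by rewrite mxE eqxx andbT; case: eqP => _; rewrite ?mul1r ?mul0r.
by rewrite mxE mj andbF mul0r.
Qed.

Lemma mxM_delta i j (Y : 'M[S]_n.+1) k l :
  (Y * delta_mx i j) k l = if l == j then Y k i else 0.
Proof.
rewrite mxE (bigD1 i) //= big1 ?addr0 => [|m /negPf mj].
  by rewrite mxE eqxx /=; case: eqP => _; rewrite ?mulr1 ?mulr0.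
by rewrite mxE mj mulr0.
Qed.

Lemma comm_copies b c :
  emb1 (X b : Mat) * emb2 (X c : Mat) - emb2 (X c : Mat) * emb1 (X b : Mat) =
  if b == c then st_iota _ h * (flip S n * emb2 (X b : Mat) - emb2 (X b : Mat) * flip S n)
  else 0.
Proof.
apply/matrixP => i j; rewrite [LHS]mxE [X in _ + X]mxE.
rewrite [(_ * emb2 _) i j]mulmx_scalar [(emb2 _ * _) i j]scalar_mulmx.
rewrite mxE; apply/matrixP => k l; rewrite [LHS]mxE [X in _ + X]mxE.
rewrite [X in X + _]scalar_mulmx [X in _ - X]mulmx_scalar XX.
case: eqP => [_|_]; last by rewrite !mxE.
have iotaE (Z : mat_star_trace Mat n) :
    (st_iota _ h * Z) i j k l = st_iota S h * (Z : 'M[Mat]_n.+1) i j k l.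
  by rewrite -!iota_mulmx.
rewrite [RHS]iotaE; congr (_ * _).
rewrite [X in _ = fun_of_matrix X k l]mxE [X in _ = fun_of_matrix (_ + X) k l]mxE.
rewrite [X in _ = fun_of_matrix (X + _) k l]mulmx_scalar.
rewrite [X in _ = fun_of_matrix (_ - X) k l]scalar_mulmx.
rewrite [RHS]mxE [X in _ = _ + X]mxE [flip S n i j]mxE.
by rewrite [X in _ = X + _]delta_mxM [X in _ = _ - X]mxM_delta [k == j]eq_sym [l == i]eq_sym.
Qed.

(** Leibniz rule. Only the letters [true] contribute, and the two terms of the bracket cut the word
    at such a letter, one just before it and one just after it. *)
Lemma comm_word w i j k l :
  X true i j * word_value X w k l - word_value X w k l * X true i j =
  iota_ h * \sum_(0 <= s < size w | nth false w s)
    (word_value X (take s w) k j * word_value X (drop s w) i l -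
     word_value X (take s.+1 w) k j * word_value X (drop s.+1 w) i l).
Proof.
elim: w k => [|c w IHw] k.
  rewrite big_geq // mulr0 /word_value big_nil mxE.
  by case: (k == l); rewrite ?mulr1 ?mul1r ?mulr0 ?mul0r subrr.
have nil : word_value X [::] = 1 by exact: big_nil.
have cons u : word_value X (c :: u) = X c * word_value X u by rewrite /word_value big_cons.
have consE u a b : word_value X (c :: u) a b = \sum_m X c a m * word_value X u m b.
  by rewrite cons mxE.
rewrite [size _]/= big_mkcond big_nat_recl // -big_mkcond /=.
rewrite consE mulr_sumr mulr_suml -sumrB.
rewrite (eq_bigr (fun m => (X true i j * X c k m - X c k m * X true i j) * word_value X w m l +
   X c k m * (X true i j * word_value X w m l - word_value X w m l * X true i j))); last first.
  by move=> m _; rewrite mulrBl mulrBr !mulrA addrA subrK.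
rewrite big_split /= mulrDr; congr (_ + _).
  rewrite take0 drop0 nil consE.
  under eq_bigr do rewrite XX.
  case: c cons consE => cons consE /=; last by rewrite mulr0 big1 // => m _; rewrite mul0r.
  under eq_bigr do rewrite -mulrA mulrBl.
  rewrite -mulr_sumr sumrB; congr (_ * (_ - _)).
    rewrite mxE eq_sym; case: (k == j); last by rewrite mul0r big1 // => m _; rewrite mul0r.
    by rewrite mul1r.
  rewrite cons nil mulr1 (bigD1 i) //= eqxx big1 ?addr0 // => m mi.
  by rewrite eq_sym (negPf mi) mul0r.
under eq_bigr do rewrite IHw mulrA -iotaC -mulrA mulr_sumr.
rewrite -mulr_sumr exchange_big /=; congr (_ * _); apply: eq_bigr => s _.
by rewrite !consE !mulr_suml -sumrB; apply: eq_bigr => m _; rewrite mulrBr !mulrA.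
Qed.

(* Since phi is tracial, [sum_ij phi ([X_ij, W_ji T]) = 0]. *)
Lemma loop_equation w (T : S) :
  h * st_phi S ((\sum_(0 <= s < size w | nth false w s)
      (ptr (word_value X (take s w) : Mat) * ptr (word_value X (drop s w) : Mat) -
       ptr (word_value X (take s.+1 w) : Mat) * ptr (word_value X (drop s.+1 w) : Mat))) * T) =
  - (n.+1%:R^-1 * st_phi Mat ((word_value X w : Mat) *
       ((X true : Mat) * (T%:M : Mat) - (T%:M : Mat) * (X true : Mat)))).
Proof.
set L := \sum_(0 <= s < _ | _) _.
set W := word_value X w.
have iotaN (Y : Mat) : st_iota S n.+1%:R * ptr Y = \sum_i (Y : 'M[S]_n.+1) i i.
  by rewrite mulrA -rmorphM mulfV ?pnatr_eq0 // rmorph1 mul1r.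
have NN a b : st_iota S n.+1%:R * ptr a * (st_iota S n.+1%:R * ptr b) =
    st_iota S n.+1%:R * st_iota S n.+1%:R * (ptr a * ptr b).
  by rewrite mulrA -[in LHS](mulrA (st_iota S n.+1%:R) (ptr a)) -[ptr a * st_iota _ _]iotaC !mulrA.
(* Taking (k, l) = (j, i) in [comm_word] and summing over i and j closes both pieces of the cut word
   into full traces, that is, into N^2 times a product of two normalized ones. *)
have NL : st_iota S n.+1%:R * st_iota S n.+1%:R * (st_iota S h * L) =
    \sum_i \sum_j (X true i j * W j i - W j i * X true i j).
  under eq_bigr do under eq_bigr do rewrite comm_word.
  under eq_bigr do rewrite -mulr_sumr.
  rewrite -mulr_sumr mulrA -(iotaC h) -mulrA; congr (_ * _).
  under [RHS]eq_bigr do rewrite exchange_big.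
  rewrite [RHS]exchange_big /= mulr_sumr; apply: eq_bigr => s _.
  rewrite mulrBr -!NN !iotaN !mulr_suml -sumrB [RHS]exchange_big /=; apply: eq_bigr => j _.
  by rewrite !mulr_sumr -sumrB.
have key i j : st_phi S (X true i j * W j i * T) = st_phi S (W j i * T * X true i j).
  by rewrite -mulrA phiC.
have N0 : n.+1%:R != 0 :> C by rewrite pnatr_eq0.
(* The left side carries N^2 from two traces, the right side only N from the single trace in
   [mat_phi]: hence the factor 1 / N of the statement. *)
apply: (mulfI N0); apply: (mulfI N0); rewrite [RHS]mulrCA mulrN mulVKf //.
transitivity (st_phi S (st_iota S n.+1%:R * st_iota S n.+1%:R * (st_iota S h * L) * T)).
  by rewrite -!mulrA !phi_iota.
rewrite NL mulr_suml raddf_sum.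
have sumE i : st_phi S ((\sum_j (X true i j * W j i - W j i * X true i j)) * T) =
   \sum_j st_phi S (W j i * (T * X true i j - X true i j * T)).
  rewrite mulr_suml raddf_sum; apply: eq_bigr => j _.
  by rewrite mulrBl mulrBr !raddfB /= key !mulrA.
rewrite (eq_bigr _ (fun i _ => sumE i)) exchange_big /=.
rewrite mat_phiE mulrN mulVKf // -sumrN; apply: eq_bigr => j _.
rewrite -sumrN; apply: eq_bigr => i _.
have -> : (X true * T%:M - T%:M * X true) i j = - (T * X true i j - X true i j * T).
  by rewrite mxE [X in _ + X]mxE mulmx_scalar scalar_mulmx opprB.
by rewrite mulrN raddfN opprK.
Qed.
End Bracket.

(** * Asymptotic relations between the joint moments *)

Section ModelAsymptotics.
Variables (C : numClosedFieldType) (h : nat -> C) (S : nat -> star_trace C).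
Hypothesis h_gt0 : forall n, 0 < h n.
Let M n := mat_star_trace (S n) n.
Variables (X : forall n, bool -> M n) (m : nat -> bool -> nat -> C).
Hypothesis X_bracket : forall n, gl_bracket (h n) (@X n).
Hypothesis X_star : forall n b, st_star (M n) (X n b) = X n b.
Hypothesis X_pure : forall n b k, ptr (X n b ^+ k) = st_iota (S n) (m n b k).
Hypothesis m_bounded : forall b k, (0 < k)%N -> exists c, forall n, m n b k <= c.

Definition joint_moment n (Ws : seq (seq bool)) : C :=
  st_phi (S n) (\prod_(w <- Ws) ptr (word_value (@X n) w)).

(** By self-adjointness the moment of order k is the trace of X^(2^(k+1)), which [X_pure] identifies
    with a power sum. *)
Lemma bounded_X b : @bounded_moments C M (fun n => X n b).
Proof.
move=> k; have [|c cm] := @m_bounded b (2 ^ k.+1); first by rewrite expn_gt0.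
exists c => n; rewrite /moment X_star -expr2 -exprM -expnS -phi_ptr X_pure.
by rewrite -[st_iota _ _]mulr1 phi_iota phi1 mulr1.
Qed.

Lemma bounded_word w : @bounded_moments C M (fun n => word_value (@X n) w).
Proof. by apply: (@bounded_prod C M bool w (fun b n => X n b)) => b; exact: bounded_X. Qed.

(** [small_comm_ptr] replaces the partial trace by the word itself in a second copy. There the
    Leibniz rule reduces the claim to single letters, where [comm_copies] shows the factor [h]. *)
Lemma small_comm_letter b w :
  @small C h M (commutator (fun n => X n b) (fun n => (ptr (word_value (@X n) w))%:M : M n)).
Proof.
apply: small_comm_ptr; apply: (@small_eq _ _ _ (commutator (fun n => emb1 (X n b))
   (fun n => \prod_(c <- w) emb2 (X n c)))).
  move=> n; rewrite /commutator; have -> : emb2 (word_value (@X n) w) = \prod_(c <- w) emb2 (X n c).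
    rewrite /word_value; elim: w => [|c w IHw]; first by rewrite !big_nil.
    by rewrite !big_cons emb2M IHw.
  by [].
apply: (@small_comm_prod C h (fun n => mat_star_trace (M n) n) _ _ w (fun c n => emb2 (X n c))) => c.
  by apply: bounded_emb2; apply: bounded_X.
have bF : @bounded_moments C (fun n => mat_star_trace (M n) n) (fun n => flip (S n) n) by exact: bounded_flip.
have bX := bounded_emb2 (bounded_X c); case: (eqVneq b c) => [bc|bc]; last first.
  have z : @small C h (fun n => mat_star_trace (M n) n) (fun n => 0) := @small0 C h _.
  by apply: small_eq z => n; rewrite /commutator (comm_copies (@X_bracket n)) (negPf bc).
apply: small_eq (small_add (small_iota h_gt0 (bounded_mul bF bX))
   (small_opp (small_iota h_gt0 (bounded_mul bX bF)))) => n.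
by rewrite /commutator (comm_copies (@X_bracket n)) bc eqxx mulrBr.
Qed.

Lemma small_comm_word v Ws :
  @small C h M (commutator (fun n => word_value (@X n) v)
    (fun n => (\prod_(w <- Ws) ptr (word_value (@X n) w))%:M : M n)).
Proof.
apply: small_comm_sym; apply: (@small_comm_prod C h M _ _ v (fun b n => X n b)) => b.
  exact: bounded_X.
apply: small_comm_sym; apply: (@small_eq _ _ _ (commutator (fun n => X n b)
   (fun n => \prod_(w <- Ws) ((ptr (word_value (@X n) w))%:M : M n)))).
  move=> n; rewrite /commutator; congr (_ * _ - _ * _); elim: Ws => [|w Ws IHw].
  - by rewrite !big_nil.
  - by rewrite !big_cons IHw scalar_mxM.
  - by rewrite !big_nil.
  - by rewrite !big_cons IHw scalar_mxM.
apply: (@small_comm_prod C h M _ _ Ws (fun w n => (ptr (word_value (@X n) w))%:M : M n)) => w.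
  exact: (@bounded_scalar C S (fun n => n) _ (bounded_ptr (bounded_word w))).
exact: small_comm_letter.
Qed.

Lemma joint_moment_nil n : joint_moment n [::] = 1.
Proof. by rewrite /joint_moment big_nil phi1. Qed.

Lemma joint_moment_pure n b k Ws :
  joint_moment n (nseq k b :: Ws) = m n b k * joint_moment n Ws.
Proof. by rewrite /joint_moment big_cons word_value_nseq X_pure phi_iota. Qed.

Lemma joint_moment_cons n w Ws : joint_moment n (w :: Ws) =
  st_phi (M n) ((word_value (@X n) w : M n) *
    ((\prod_(w <- Ws) ptr (word_value (@X n) w))%:M : M n)).
Proof. by rewrite /joint_moment big_cons phi_ptr_mul. Qed.

(** The scalar trace is exactly cyclic, but rotating v also drags it across the product T of the
    other partial traces. The error is the trace of W [T, V], with a small commutator. *)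
Lemma joint_moment_cyclic v w Ws : exists c, forall n,
  `|joint_moment n ((v ++ w) :: Ws) - joint_moment n ((w ++ v) :: Ws)| <= c * h n.
Proof.
have [c ce] := small_comm_word v Ws (bounded_word w); exists c => n.
apply: le_trans (ce n); rewrite -normrN opprB !joint_moment_cons !word_value_cat.
set T := _%:M; set V := word_value _ v; set W := word_value _ w.
have e : st_phi (M n) (W * (T * V)) = st_phi (M n) (V * W * T) by rewrite mulrA phiC mulrA.
by rewrite /commutator mulrBr raddfB /= -[mat_phi _]/(st_phi (M n) _) -[mat_phi (W * (T * V))]/(st_phi (M n) _) e !mulrA lexx.
Qed.

(** The right side of [loop_equation] is 1 / N times a trace against the commutator of A with the
    remaining partial traces. That trace is O(h), and dividing by the [h] on the left leaves O(1 /
    N). *)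
Lemma joint_moment_loop w Ws : exists c, forall n,
  `|\sum_(0 <= s < size w | nth false w s)
     (joint_moment n [:: take s w, drop s w & Ws] -
      joint_moment n [:: take s.+1 w, drop s.+1 w & Ws])| <= c / n.+1%:R.
Proof.
have [c ce] := small_comm_word [:: true] Ws (bounded_word w); exists c => n.
have := loop_equation (@X_bracket n) w (\prod_(w <- Ws) ptr (word_value (@X n) w)).
have := ce n; rewrite /commutator /word_value big_seq1 -!/(word_value _ _) => le eq.
rewrite -(ler_pM2l (h_gt0 n)) -[h n in leLHS]gtr0_norm // -normrM.
have -> : \sum_(0 <= s < size w | nth false w s)
     (joint_moment n [:: take s w, drop s w & Ws] -
      joint_moment n [:: take s.+1 w, drop s.+1 w & Ws]) =
   st_phi (S n) ((\sum_(0 <= s < size w | nth false w s)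
      (ptr (word_value (@X n) (take s w) : M n) * ptr (word_value (@X n) (drop s w) : M n) -
       ptr (word_value (@X n) (take s.+1 w) : M n) * ptr (word_value (@X n) (drop s.+1 w) : M n))) *
       \prod_(w <- Ws) ptr (word_value (@X n) w)).
  rewrite mulr_suml raddf_sum; apply: eq_bigr => s _.
  by rewrite mulrBl raddfB /joint_moment !big_cons !mulrA.
rewrite eq normrN normrM gtr0_norm ?invr_gt0 ?ltr0n // mulrA [leRHS]mulrC [h n * c]mulrC.
by rewrite ler_pM2l ?invr_gt0 ?ltr0n.
Qed.
End ModelAsymptotics.

(** * Free independence *)

Section FreeLoopEquation.
Variables (K : fieldType) (AA : algType K) (tau : {scalar AA}) (A B : AA).
Hypotheses (tau1 : tau 1 = 1) (AB_free : freely_independent tau A B).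
Notation letter := (bool * {poly K})%type.
Notation val := (letter_value A B).

Definition letters_value (w : seq letter) : AA := \prod_(u <- w) val u.

Lemma letters_value_cons u w : letters_value (u :: w) = val u * letters_value w.
Proof. exact: big_cons. Qed.

Lemma letters_value_cat v w :
  letters_value (v ++ w) = letters_value v * letters_value w.
Proof. exact: big_cat. Qed.

(* The value of [tau (x) tau] on [(x (x) 1) . D w], where D is the derivation
   with [D A = 1 (x) A - A (x) 1] and [D B = 0]. *)
Fixpoint liberation (x : AA) (w : seq letter) : K :=
  if w is u :: w' then
    (if u.1 then tau x * tau (letters_value w) - tau (x * val u) * tau (letters_value w')
     else 0) + liberation (x * val u) w'
  else 0.

Lemma liberation_catE v : forall x w w', letters_value w = letters_value w' ->
  (forall y, liberation y w = liberation y w') ->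
  liberation x (v ++ w) = liberation x (v ++ w').
Proof.
elim: v => //= u v IHv x w w' ww lw.
by rewrite (IHv _ _ _ ww lw) !letters_value_cons !letters_value_cat ww.
Qed.

(** The cut between the two letters occurs once with each sign and cancels. In other words, D f(A) =
    1 (x) f(A) - f(A) (x) 1 for every polynomial f. *)
Lemma liberation_merge x b p q v w :
  liberation x (v ++ (b, p) :: (b, q) :: w) = liberation x (v ++ (b, p * q) :: w).
Proof.
have vM : val (b, p * q) = val (b, p) * val (b, q).
  by rewrite /letter_value /=; case: b; rewrite rmorphM.
apply: liberation_catE => [|y]; first by rewrite !letters_value_cons vM mulrA.
rewrite /= !letters_value_cons vM !mulrA; case: b {vM}; rewrite ?add0r //.
by rewrite addrA addrA subrK.
Qed.

Lemma val_sub b p c : val (b, p) = val (b, p - c%:P) + c *: 1.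
Proof.
by rewrite /letter_value /=; case: b; rewrite rmorphB /= horner_algC subrK.
Qed.

(** D kills scalars, so by linearity the constant split off from a letter contributes [c] times the
    value on the word without that letter. *)
Lemma liberation_center b p c v : forall x w,
  liberation x (v ++ (b, p) :: w) =
  liberation x (v ++ (b, p - c%:P) :: w) + c * liberation x (v ++ w).
Proof.
have linl x y w : liberation (x + c *: y) w = liberation x w + c * liberation y w.
  elim: w x y => [|u w IHw] x y /=; first by rewrite mulr0 addr0.
  rewrite mulrDl -scalerAl IHw; case: u.1; last by ring.
  by rewrite !linearD /= !linearZ /=; ring.
have tauL x y : tau (x + c *: y) = tau x + c * tau y by rewrite linearD linearZ.
have valE t w : letters_value (t ++ (b, p) :: w) =
    letters_value (t ++ (b, p - c%:P) :: w) + c *: letters_value (t ++ w).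
  rewrite !letters_value_cat !letters_value_cons (val_sub b p c) mulrDl mulrDr.
  by rewrite -scalerAl mul1r -scalerAr.
elim: v => [|u v IHv] x w.
  rewrite !cat0s /=; have := valE [::] w; rewrite !cat0s => ->.
  rewrite (val_sub b p c) mulrDr -scalerAr mulr1 linl !tauL.
  by case: b {valE} => /=; ring.
rewrite /= IHv -!cat_cons !valE !tauL.
by case: u.1; ring.
Qed.

Definition alternating : pred (seq letter) := sorted (fun u v => u.1 != v.1).
Definition centered (w : seq letter) := forall u, u \in w -> tau (val u) = 0.

Lemma alternatingE w : alternating w = sorted (fun x y : bool => x != y) (map fst w).
Proof. by rewrite sorted_map. Qed.

(** In each of the two products of a cut, the factor that contains the letter u is the trace of a
    nonempty alternating centered word, so it vanishes even if the other factor is tau 1 = 1. *)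
Lemma liberation_centered v w : alternating (v ++ w) -> centered (v ++ w) ->
  liberation (letters_value v) w = 0.
Proof.
elim: w v => //= u w IHw v alt cen.
have vu : letters_value v * val u = letters_value (rcons v u).
  by rewrite -cats1 letters_value_cat /letters_value big_seq1.
have r1 : tau (letters_value (u :: w)) = 0.
  apply: AB_free => //; first by have := drop_sorted (size v) alt; rewrite drop_size_cat.
  by move=> x xw; apply: cen; rewrite mem_cat xw orbT.
have r2 : tau (letters_value v * val u) = 0.
  rewrite vu; apply: AB_free; first by case: (v).
    by move: alt; rewrite -cat_rcons => /(take_sorted (size (rcons v u))); rewrite take_size_cat.
  by move=> x xv; apply: cen; rewrite -cat_rcons mem_cat xv.
rewrite r1 r2 mulr0 mul0r subr0 if_same add0r vu.
by apply: IHw; rewrite cat_rcons.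
Qed.

(** Induction on the length. Two neighbours from the same algebra merge into one letter; in an
    alternating word the letters are centered, at the price of shorter words; [liberation_centered]
    handles what remains. *)
Lemma liberation_free w : liberation 1 w = 0.
Proof.
have [n] := ubnP (size w); elim: n w => // n IHn w; rewrite ltnS => wn.
case: (boolP (alternating w)) => [alt|nalt].
  (* The letters of v are already centered and those of u are treated from left to right. The words
     with a letter removed may fail to alternate, but they are shorter, so [IHn] covers them. *)
  suff H u v : alternating (v ++ u) -> centered v -> (size (v ++ u) <= n)%N ->
     liberation 1 (v ++ u) = 0 by apply: (H w [::]).
  elim: u v => [|[b p] u IHu] v.
    move=> a c _; have := @liberation_centered [::] (v ++ [::]); rewrite /letters_value big_nil; apply; rewrite //= cats0 //.
  move=> a c s; rewrite (liberation_center b p (tau (val (b, p)))).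
  rewrite [liberation 1 (v ++ u)]IHn ?mulr0 ?addr0; last first.
    by move: s; rewrite !size_cat /= addnS.
  rewrite -cat_rcons; apply: IHu; rewrite ?cat_rcons.
  - by move: a; rewrite !alternatingE !map_cat.
  - move=> x; rewrite mem_rcons inE => /orP[/eqP->|/c//].
    by have := val_sub b p (tau (val (b, p))); move=> /(congr1 tau) /eqP;
      rewrite linearD linearZ /= tau1 mulr1 -subr_eq subrr eq_sym => /eqP.
  - by move: s; rewrite !size_cat.
have [v [u [x [t [wE ut]]]]] : exists v u x t, w = v ++ u :: x :: t /\ u.1 = x.1.
  elim: w nalt {wn} => // u [//|x w] IHw /=; rewrite negb_and negbK => /orP[/eqP ux|nalt].
    by exists [::], u, x, w.
  by have [v [u' [x' [t [-> e]]]]] := IHw nalt; exists (u :: v), u', x', t.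
move: wn; rewrite wE; case: u ut {wE} => b p; case: x => b' q /= <- wn.
rewrite liberation_merge IHn //.
by move: wn; rewrite !size_cat /= addnS.
Qed.

Definition free_moment (w : seq bool) : K :=
  tau (word_value (fun b => if b then A else B) w).

Lemma free_moment_loop w :
  \sum_(0 <= s < size w | nth false w s)
    (free_moment (take s w) * free_moment (drop s w) -
     free_moment (take s.+1 w) * free_moment (drop s.+1 w)) = 0.
Proof.
pose val' b := if b then A else B; pose lift (w : seq bool) := [seq (b, 'X : {poly K}) | b <- w].
have valE b : val (b, 'X) = val' b by rewrite /letter_value /=; case: b; rewrite horner_algX.
have liftE u : letters_value (lift u) = word_value val' u.
  by rewrite /letters_value /lift big_map; apply: eq_bigr => b _; rewrite valE.
have H x u : liberation x (lift u) = \sum_(0 <= s < size u | nth false u s)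
    (tau (x * word_value val' (take s u)) * free_moment (drop s u) -
     tau (x * word_value val' (take s.+1 u)) * free_moment (drop s.+1 u)).
  elim: u x => [|b u IHu] x; first by rewrite big_geq.
  have nil : word_value val' [::] = 1 by exact: big_nil.
  have cons t : word_value val' (b :: t) = val' b * word_value val' t by exact: big_cons.
  rewrite [size _]/= big_mkcond big_nat_recl // -big_mkcond /= IHu -/(lift u).
  rewrite take0 drop0 nil mulr1 letters_value_cons liftE valE cons nil mulr1.
  congr (_ + _); first by rewrite /free_moment cons; case: (b).
  by apply: eq_bigr => s _; rewrite !cons !mulrA.
rewrite -[RHS](liberation_free (lift w)) H; apply: eq_bigr => s _.
by rewrite !mul1r.
Qed.
End FreeLoopEquation.

(** * Traces of powers on a highest weight vector *)

Section WeightedSum.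
Variables (F : fieldType) (h : F).

(* [sum_{y in s} f y * prod_{y' <> y} (1 - h / (y - y'))], by recursion on [s] *)
Fixpoint wsum (f : F -> F) (s : seq F) : F :=
  if s is c :: s' then
    f c * \prod_(y <- s') (1 - h / (c - y)) + wsum (fun y => f y * (1 - h / (y - c))) s'
  else 0.

Lemma eq_wsum f g s : {in s, f =1 g} -> wsum f s = wsum g s.
Proof.
elim: s f g => //= c s IHs f g fg; rewrite fg ?mem_head //; congr (_ + _).
by apply: IHs => y ys; rewrite fg // inE ys orbT.
Qed.

Lemma wsum_lin a b f g s :
  wsum (fun y => a * f y + b * g y) s = a * wsum f s + b * wsum g s.
Proof.
elim: s f g => [|c s IHs] f g /=; first by rewrite !mulr0 addr0.
rewrite (@eq_wsum _ (fun y => a * (f y * (1 - h / (y - c))) + b * (g y * (1 - h / (y - c))))).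
  by rewrite IHs; ring.
by move=> y _; ring.
Qed.

(** Partial fractions in z: the residue of the product at y is -h times the weight of y in
    [wsum]. *)
Lemma wsum_partial_fraction z s : uniq (z :: s) ->
  \prod_(y <- s) (1 - h / (z - y)) = 1 - h * wsum (fun y => (z - y)^-1) s.
Proof.
elim: s z => [|c s IHs] z; first by rewrite big_nil /= mulr0 subr0.
rewrite /= inE negb_or => /and3P[/andP[zc zs] cs us].
rewrite big_cons !IHs /= ?zs ?cs // mulrDr.
have zc0 : z - c != 0 by rewrite subr_eq0.
set q1 := wsum (fun y => (z - y)^-1) s; set q2 := wsum (fun y => (c - y)^-1) s.
have -> : wsum (fun y => (z - y)^-1 * (1 - h / (y - c))) s =
   (1 - h / (z - c)) * q1 + (h / (z - c)) * q2.
  rewrite -wsum_lin; apply: eq_wsum => y ys.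
  have zy0 : z - y != 0 by rewrite subr_eq0; apply: contraNneq zs => ->.
  have yc0 : y - c != 0 by rewrite subr_eq0; apply: contraNneq cs => <-.
  have cy0 : c - y != 0 by rewrite subr_eq0 eq_sym -subr_eq0.
  by field; rewrite yc0 cy0 zc0 zy0.
by field.
Qed.

(** When c is adjoined, its own weight is 1 minus h times the sum of w_y / (c - y), and the other
    weights w_y grow in total by exactly that amount. *)
Lemma wsum_1 s : uniq s -> wsum (fun=> 1) s = (size s)%:R.
Proof.
elim: s => //= c s IHs /andP[cs us]; rewrite wsum_partial_fraction /= ?cs // mul1r.
rewrite (@eq_wsum (fun y => 1 * (1 - h / (y - c))) (fun y => 1 * 1 + h * (c - y)^-1)); last first.
  by move=> y ys /=; rewrite -[y - c]opprB invrN; ring.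
by rewrite wsum_lin IHs //= -[in RHS]addn1 natrD; ring.
Qed.

(** On s, the factor y - c turns 1 - h / (y - c) into y - c - h, which removes c from the weights;
    at c itself it vanishes. *)
Lemma wsum_exprS k c s : c \notin s ->
  wsum (fun y => y ^+ k.+1) (c :: s) = c * wsum (fun y => y ^+ k) (c :: s) +
    (wsum (fun y => y ^+ k.+1) s - (c + h) * wsum (fun y => y ^+ k) s).
Proof.
move=> cs /=.
rewrite (@eq_wsum _ (fun y => c * (y ^+ k * (1 - h / (y - c))) +
   1 * (1 * (y ^+ k.+1) + (- (c + h)) * y ^+ k)) s).
  by rewrite !wsum_lin exprS; ring.
move=> y ys; have yc0 : y - c != 0 by rewrite subr_eq0; apply: contraNneq cs => <-.
by rewrite exprS; field.
Qed.

Lemma wsum_map (I : eqType) (a : I -> F) f (r : seq I) : uniq r ->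
  wsum f [seq a i | i <- r] =
  \sum_(i <- r) f (a i) * \prod_(j <- r | j != i) (1 - h / (a i - a j)).
Proof.
elim: r f => [|c r IHr] f /=; first by rewrite big_nil.
move=> /andP[cr ur]; rewrite big_cons big_map big_cons eqxx /=; congr (_ * _ + _).
  by rewrite big_seq_cond [RHS]big_seq_cond; apply: eq_bigl => i;
    case: (boolP (i \in r)) => //= ir; apply/esym; apply: contraNneq cr => <-.
rewrite IHr //; apply: eq_big_seq => i ir.
rewrite big_cons; have -> : c != i by apply: contraNneq cr => ->.
by rewrite !mulrA.
Qed.

Variables (N : nat) (a : 'I_N -> F) (x : nat -> 'I_N -> F).
Hypothesis a_inj : injective a.
Hypothesis x0 : forall i, x 0 i = 1.
Hypothesis xS : forall k i, x k.+1 i = a i * x k i - h * \sum_(p < N | (i < p)%N) x k p.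

(* Both sides, restricted to the indices [>= m], obey the same recursion in [m]. *)
Lemma perelomov_popov_sum k :
  \sum_i x k i = \sum_i a i ^+ k * \prod_(j < N | j != i) (1 - h / (a i - a j)).
Proof.
have -> : \sum_i a i ^+ k * \prod_(j < N | j != i) (1 - h / (a i - a j)) =
    wsum (fun y => y ^+ k) [seq a i | i <- enum 'I_N].
  rewrite wsum_map ?enum_uniq // big_enum; apply: eq_bigr => i _.
  by rewrite big_enum_cond; congr (_ * _); apply: eq_bigl => j; rewrite andbT.
suff H d m : (d + m = N)%N -> wsum (fun y => y ^+ k) [seq a i | i <- drop m (enum 'I_N)] =
    \sum_(i < N | (m <= i)%N) x k i by rewrite -[enum _]drop0 (H N) ?addn0 //; apply: eq_bigl.
elim: d m k => [|d IHd] m k.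
  rewrite add0n => ->; rewrite drop_oversize ?size_enum_ord //= big1 // => i.
  by rewrite leqNgt ltn_ord.
move=> dm; have mN : (m < N)%N by lia.
pose c := Ordinal mN.
have dropE : drop m (enum 'I_N) = c :: drop m.+1 (enum 'I_N).
  by rewrite (drop_nth c) ?size_enum_ord //; congr (_ :: _); apply: val_inj; rewrite /= nth_enum_ord.
have IH k' := IHd m.+1 k' ltac:(lia).
have sumE k' : \sum_(i < N | (m <= i)%N) x k' i = x k' c + \sum_(i < N | (m < i)%N) x k' i.
  rewrite (bigD1 c) //=; congr (_ + _); apply: eq_bigl => i.
  by rewrite ltn_neqAle andbC -val_eqE /= eq_sym.
have us : uniq [seq a i | i <- drop m (enum 'I_N)] by rewrite map_inj_uniq // drop_uniq // enum_uniq.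
elim: k => [|k IHk].
  rewrite (@eq_wsum _ (fun=> 1)) ?wsum_1 //.
  rewrite sumE -IH (@eq_wsum _ (fun=> 1)) ?wsum_1 //; last by rewrite map_inj_uniq // drop_uniq // enum_uniq.
  by rewrite dropE /= x0 -add1n natrD.
move: us IHk; rewrite !sumE dropE map_cons => /andP[cs _] IHk.
by rewrite wsum_exprS // IHk !IH xS; ring.
Qed.
End WeightedSum.

(** * The eigenvalues of the diagonal entries of powers on the highest weight vector *)

Section HighestWeight.
Variables (K : fieldType) (N n : nat) (h : K) (A : 'M['M[K]_n]_N).
Hypothesis A_bracket : forall i j k l, A i j *m A k l - A k l *m A i j =
  h *: ((if j == k then A i l else 0) - (if i == l then A k j else 0)).
Variables (v : 'cV[K]_n) (lam : 'I_N -> K).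
Hypothesis v_neq0 : v != 0.
Hypothesis A_upper : forall i j : 'I_N, (i < j)%N -> A i j *m v = 0.
Hypothesis A_diag : forall i, A i i *m v = (h * lam i) *: v.

Lemma mxpowS k i j : (A ^+ k.+1) i j = \sum_p A i p *m (A ^+ k) p j.
Proof. by rewrite exprS mxE. Qed.

(** The matrix A is equivariant under gl_N, so each of its powers has the same bracket with A as A
    itself. *)
Lemma bracket_pow k i j p q : A i j *m (A ^+ k) p q - (A ^+ k) p q *m A i j =
  h *: ((if j == p then (A ^+ k) i q else 0) - (if i == q then (A ^+ k) p j else 0)).
Proof.
elim: k p => [|k IHk] p.
  rewrite expr0 !mxE.
  have commI b : A i j *m b%:R = b%:R *m A i j :> 'M[K]_n.
    by rewrite -!scaler_nat -scalemxAl -scalemxAr; congr (_ *: _); exact: etrans (mulmx1 _) (esym (mul1mx _)).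
  rewrite commI subrr [p == j]eq_sym.
  by case: (j == p); case: (i == q); rewrite /= ?subrr ?scaler0.
rewrite !mxpowS mulmx_sumr mulmx_suml -sumrB.
rewrite (eq_bigr (fun m => (A i j *m A p m - A p m *m A i j) *m (A ^+ k) m q +
   A p m *m (A i j *m (A ^+ k) m q - (A ^+ k) m q *m A i j))); last first.
  by move=> m _; rewrite mulmxBl mulmxBr !mulmxA addrA subrK.
rewrite big_split /=.
under eq_bigr do rewrite A_bracket -scalemxAl mulmxBl.
under [X in _ + X]eq_bigr do rewrite IHk -scalemxAr mulmxBr.
rewrite -!scaler_sumr -scalerDr !sumrB; congr (_ *: _).
have -> : \sum_i0 (if j == p then A i i0 else 0) *m (A ^+ k) i0 q =
   if j == p then (A ^+ k.+1) i q else 0.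
  by case: (j == p); rewrite ?mxpowS // big1 // => m _; rewrite mul0mx.
have -> : \sum_i0 (if i == i0 then A p j else 0) *m (A ^+ k) i0 q = A p j *m (A ^+ k) i q.
  by rewrite (bigD1 i) //= eqxx big1 ?addr0 // => m mi; rewrite eq_sym (negPf mi) mul0mx.
have -> : \sum_i0 A p i0 *m (if j == i0 then (A ^+ k) i q else 0) = A p j *m (A ^+ k) i q.
  by rewrite (bigD1 j) //= eqxx big1 ?addr0 // => m mj; rewrite eq_sym (negPf mj) mulmx0.
have -> : \sum_i0 A p i0 *m (if i == q then (A ^+ k) i0 j else 0) =
   if i == q then (A ^+ k.+1) p j else 0.
  by case: (i == q); rewrite ?mxpowS // big1 // => m _; rewrite mulmx0.
by rewrite addrA subrK !mxpowS.
Qed.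

Lemma pow_upper k (i j : 'I_N) : (i < j)%N -> (A ^+ k) i j *m v = 0.
Proof.
elim: k i j => [|k IHk] i j ij.
  have ij' : (i == j) = false by apply/eqP => e; rewrite e ltnn in ij.
  by rewrite expr0 mxE ij' mul0mx.
rewrite mxpowS mulmx_suml big1 // => p _; rewrite -mulmxA.
have [pj|jp] := ltnP p j; first by rewrite IHk // mulmx0.
have ip : (i < p)%N by apply: leq_trans jp.
have ij' : (i == j) = false by apply/eqP => e; rewrite e ltnn in ij.
rewrite mulmxA; have /(canRL (subrK _)) -> := bracket_pow k i p p j.
rewrite eqxx ij' subr0 mulmxDl -scalemxAl IHk // -mulmxA A_upper // mulmx0.
by rewrite scaler0 addr0.
Qed.

Definition weight_coef (k : nat) : 'I_N -> K :=
  iter k (fun x i => h * (lam i + (N - i.+1)%:R) * x i - h * \sum_(p < N | (i < p)%N) x p) (fun=> 1).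

(** In the sum of A_ip (A^k)_pi over p, the terms p < i die by [pow_upper], and for p > i only the
    commutator survives, equal to h (x_i - x_p). The N - i - 1 such indices p shift [lam i] to the
    configuration point, and the result is the recursion of [perelomov_popov_sum]. *)
Lemma pow_diag k (i : 'I_N) : (A ^+ k) i i *m v = weight_coef k i *: v.
Proof.
elim: k i => [|k IHk] i; first by rewrite expr0 mxE eqxx /= scale1r; exact: mul1mx.
rewrite mxpowS mulmx_suml (bigID (fun p : 'I_N => (p <= i)%N)) /=.
rewrite (bigD1 i) //= [X in _ + X + _]big1 ?addr0 => [|p /andP[pi ne]]; last first.
  by rewrite -mulmxA pow_upper ?mulmx0 // ltn_neqAle pi andbT.
rewrite -mulmxA IHk -scalemxAr A_diag scalerA.
rewrite (eq_bigr (fun p => (h * (weight_coef k i - weight_coef k p)) *: v)) => [|p]; last first.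
  rewrite -ltnNge => ip; have /(canRL (subrK _)) -> := bracket_pow k i p p i.
  rewrite !eqxx mulmxDl -scalemxAl mulmxBl !IHk -mulmxA A_upper // mulmx0 addr0.
  by rewrite -scalerBl scalerA.
rewrite -scaler_suml -scalerDl; congr (_ *: _).
rewrite -mulr_sumr sumrB sumr_const.
have -> : #|[pred p : 'I_N | ~~ (p <= i)%N]| = (N - i.+1)%N.
  rewrite -sum1_card -[RHS]muln1 -sum_nat_const_nat big_geq_mkord.
  by apply: eq_bigl => p; rewrite inE -ltnNge.
rewrite -[RHS]/(h * (lam i + (N - i.+1)%:R) * weight_coef k i -
  h * \sum_(p < N | (i < p)%N) weight_coef k p).
rewrite -[_ *+ (N - _)]mulr_natl.
rewrite (eq_bigl (fun p : 'I_N => (i < p)%N)) => [|p]; last by rewrite ltnNge.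
by ring.
Qed.

Lemma highest_weight_trace k c : \sum_i (A ^+ k) i i = c%:M ->
  injective (fun i : 'I_N => h * (lam i + (N - i.+1)%:R)) ->
  c = \sum_i (h * (lam i + (N - i.+1)%:R)) ^+ k *
    \prod_(j < N | j != i) (1 - h / (h * (lam i + (N - i.+1)%:R) - h * (lam j + (N - j.+1)%:R))).
Proof.
move=> trA a_inj.
rewrite -(perelomov_popov_sum (x := weight_coef) a_inj) //.
have : (c - \sum_i weight_coef k i) *: v = 0.
  rewrite scalerBl -mul_scalar_mx -trA mulmx_suml scaler_suml -sumrB big1 // => i _.
  by rewrite pow_diag subrr.
by move/eqP; rewrite scaler_eq0 (negPf v_neq0) orbF subr_eq0 => /eqP.
Qed.
End HighestWeight.

(** * The tensor product of two representations *)

Section BaseStarTrace.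
Variables (K : numClosedFieldType) (D : nat) (T : 'M[K]_D).
Hypotheses (D_gt0 : (0 < D)%N) (TU : T \in unitmx).

Definition base_phi (X : 'M[K]_D) : K := D%:R^-1 * \tr X.
(** The adjoint for the Hermitian inner product whose Gram matrix is T^H T; conjugation by [T] turns
    it into the conjugate transpose. *)
Definition base_star (X : 'M[K]_D) : 'M[K]_D := invmx T *m (T *m X *m invmx T)^H *m T.
Definition base_iota (c : K) : 'M[K]_D := c%:M.

Fact base_phi_additive : zmod_morphism base_phi.
Proof. by move=> X Y; rewrite /base_phi linearB /= mulrBr. Qed.
HB.instance Definition _ := GRing.isZmodMorphism.Build _ _ base_phi base_phi_additive.

Fact base_star_additive : zmod_morphism base_star.
Proof.
by move=> X Y; rewrite /base_star mulmxBr mulmxBl linearB /= map_mxB mulmxBr mulmxBl.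
Qed.
HB.instance Definition _ := GRing.isZmodMorphism.Build _ _ base_star base_star_additive.

Fact base_iota_additive : zmod_morphism base_iota.
Proof. by move=> c d; rewrite /base_iota raddfB. Qed.
HB.instance Definition _ := GRing.isZmodMorphism.Build _ _ base_iota base_iota_additive.
Fact base_iota_multiplicative : monoid_morphism base_iota.
Proof. by split=> // c d; rewrite /base_iota scalar_mxM. Qed.
HB.instance Definition _ := GRing.isMonoidMorphism.Build _ _ base_iota base_iota_multiplicative.

Lemma base_star_eq X Y : (T *m X *m invmx T)^H = T *m Y *m invmx T -> base_star X = Y.
Proof.
by move=> XY; rewrite /base_star XY !mulmxA mulVmx // mul1mx mulmxKV.
Qed.

Definition hat (X : 'M[K]_D) := T *m X *m invmx T.
Lemma hatM X Y : hat (X *m Y) = hat X *m hat Y.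
Proof. by rewrite /hat !mulmxA mulmxKV. Qed.

Lemma hat_star X : hat (base_star X) = (hat X)^H.
Proof. by rewrite /hat /base_star !mulmxA mulmxV // mul1mx mulmxK. Qed.

Lemma tr_hat X : \tr (hat X) = \tr X.
Proof. by rewrite /hat mxtrace_mulC mulmxA mulVmx // mul1mx. Qed.

Lemma adjM m n p (A : 'M[K]_(m, n)) (B : 'M[K]_(n, p)) : (A *m B)^H = B^H *m A^H.
Proof. by rewrite trmx_mul map_mxM. Qed.

Lemma adjK m n (A : 'M[K]_(m, n)) : A^H^H = A.
Proof. by apply/matrixP => i j; rewrite !mxE conjCK. Qed.

Lemma tr_adj_sum (X : 'M[K]_D) :
  \tr (X *m X^H) = \sum_(k : 'I_D * 'I_D) `|X k.1 k.2| ^+ 2.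
Proof.
rewrite /mxtrace -(pair_bigA _ (fun i j => `|X i j| ^+ 2)) /=; apply: eq_bigr => i _.
by rewrite mxE; apply: eq_bigr => j _; rewrite !mxE normCK.
Qed.

Lemma base_phi1 : base_phi 1 = 1.
Proof. by rewrite /base_phi mxtrace1 mulVf // pnatr_eq0 -lt0n. Qed.

Lemma base_phiC X Y : base_phi (X * Y) = base_phi (Y * X).
Proof. by rewrite /base_phi [\tr _]mxtrace_mulC. Qed.

Lemma base_phi_iota c X : base_phi (base_iota c * X) = c * base_phi X.
Proof.
have -> : base_iota c * X = c *: X by exact: mul_scalar_mx.
by rewrite /base_phi linearZ mulrCA.
Qed.

Lemma base_phi_starE X :
  base_phi (X * base_star X) = D%:R^-1 * \sum_(k : 'I_D * 'I_D) `|hat X k.1 k.2| ^+ 2.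
Proof.
by rewrite /base_phi -[\tr _]tr_hat [hat _]hatM hat_star tr_adj_sum.
Qed.

Lemma base_phi_ge0 X : 0 <= base_phi (X * base_star X).
Proof.
by rewrite base_phi_starE mulr_ge0 ?invr_ge0 ?ler0n // sumr_ge0 // => k _; rewrite exprn_ge0.
Qed.

Lemma base_starM X Y : base_star (X * Y) = base_star Y * base_star X.
Proof.
apply: base_star_eq; rewrite -[LHS]/((hat (X *m Y))^H) -[RHS]/(hat (base_star Y *m base_star X)).
by rewrite [hat (X *m Y)]hatM adjM [RHS]hatM !hat_star.
Qed.

Lemma base_starK : involutive base_star.
Proof. by move=> X; apply: base_star_eq; rewrite -!/(hat _) hat_star adjK. Qed.

Lemma base_phi_CS X Y : `|base_phi (X * Y)| ^+ 2 <=
  base_phi (X * base_star X) * base_phi (base_star Y * Y).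
Proof.
rewrite -{3}[Y]base_starK !base_phi_starE hat_star.
rewrite /base_phi -[\tr _]tr_hat [hat _]hatM /mxtrace.
under eq_bigr do rewrite mxE; rewrite pair_big /=.
rewrite mulrACA normrM exprMn ger0_norm ?invr_ge0 ?ler0n // -expr2.
rewrite ler_wpM2l ?exprn_ge0 ?invr_ge0 ?ler0n //.
apply: cauchy_schwarz_sum => k; rewrite ?exprn_ge0 //.
by rewrite !mxE norm_conjC normrM exprMn.
Qed.

Lemma base_iotaC c X : base_iota c * X = X * base_iota c.
Proof. exact: esym (scalar_mxC _ _). Qed.

Lemma base_star_iota c : base_star (base_iota c) = base_iota c^*.
Proof.
apply: base_star_eq; rewrite /base_iota !mul_mx_scalar -!scalemxAl mulmxV //.
by rewrite !scalemx1 tr_scalar_mx map_scalar_mx.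
Qed.

Definition base_star_trace : star_trace K :=
  StarTrace base_phi1 base_phiC base_phi_iota base_phi_ge0 base_phi_CS base_starM
    base_starK base_iotaC base_star_iota.
End BaseStarTrace.

Lemma tensmx11 (K : comPzRingType) p q : (1%:M : 'M[K]_p) *t (1%:M : 'M[K]_q) = 1%:M.
Proof.
apply/matrixP => i j; case: (mxtens_indexP i) => i0 i1; case: (mxtens_indexP j) => j0 j1.
rewrite tensmxE !mxE (inj_eq (can_inj (@mxtens_indexK p q))) xpair_eqE.
by case: (i0 == j0); case: (i1 == j1); rewrite /= ?mulr1 ?mulr0.
Qed.

Section TensorModel.
Variables (K : numClosedFieldType) (n p q : nat) (h : K).
Hypotheses (p_gt0 : (0 < p)%N) (q_gt0 : (0 < q)%N).
Variables (a : 'M['M[K]_p]_n.+1) (b : 'M['M[K]_q]_n.+1) (Ta : 'M[K]_p) (Tb : 'M[K]_q).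
Hypotheses (TaU : Ta \in unitmx) (TbU : Tb \in unitmx).
Hypothesis a_adj : forall i j, (Ta *m a i j *m invmx Ta)^H = Ta *m a j i *m invmx Ta.
Hypothesis b_adj : forall i j, (Tb *m b i j *m invmx Tb)^H = Tb *m b j i *m invmx Tb.
Hypothesis a_bracket : forall i j k l, a i j *m a k l - a k l *m a i j =
  h *: ((if j == k then a i l else 0) - (if i == l then a k j else 0)).
Hypothesis b_bracket : forall i j k l, b i j *m b k l - b k l *m b i j =
  h *: ((if j == k then b i l else 0) - (if i == l then b k j else 0)).
Variables (s t : nat -> K).
Hypothesis a_trace : forall k, \sum_i (a ^+ k) i i = (n.+1%:R * s k)%:M.
Hypothesis b_trace : forall k, \sum_i (b ^+ k) i i = (n.+1%:R * t k)%:M.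

Let D_gt0 : (0 < p * q)%N. Proof. by rewrite muln_gt0 p_gt0. Qed.
Let TV : (Ta *t Tb) *m (invmx Ta *t invmx Tb) = 1%:M.
Proof. by rewrite tensmx_mul !mulmxV // tensmx11. Qed.
Let TU : Ta *t Tb \in unitmx. Proof. by have [] := mulmx1_unit TV. Qed.

Definition tensor_trace : star_trace K := base_star_trace D_gt0 TU.

Definition tensor_letter (c : bool) : 'M[tensor_trace]_n.+1 :=
  if c then \matrix_(i, j) (a i j *t 1%:M) else \matrix_(i, j) (1%:M *t b i j).

Lemma tensmxBl m1 n1 m2 n2 (A B : 'M[K]_(m1, n1)) (E : 'M[K]_(m2, n2)) :
  (A - B) *t E = A *t E - B *t E.
Proof. by apply/matrixP => i j; rewrite !mxE mulrBl. Qed.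

Lemma tensmxBr m1 n1 m2 n2 (A B : 'M[K]_(m1, n1)) (E : 'M[K]_(m2, n2)) :
  E *t (A - B) = E *t A - E *t B.
Proof. by apply/matrixP => i j; rewrite !mxE mulrBr. Qed.

Lemma tensmxZl m1 n1 m2 n2 c (A : 'M[K]_(m1, n1)) (E : 'M[K]_(m2, n2)) :
  (c *: A) *t E = c *: (A *t E).
Proof. by apply/matrixP => i j; rewrite !mxE mulrA. Qed.

Lemma tensmxZr m1 n1 m2 n2 c (A : 'M[K]_(m1, n1)) (E : 'M[K]_(m2, n2)) :
  E *t (c *: A) = c *: (E *t A).
Proof. by apply/matrixP => i j; rewrite !mxE mulrCA. Qed.

Lemma tensmx_suml (I : finType) m1 n1 m2 n2 (A : I -> 'M[K]_(m1, n1)) (E : 'M[K]_(m2, n2)) :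
  (\sum_i A i) *t E = \sum_i A i *t E.
Proof.
apply/matrixP => x y; rewrite !mxE !summxE mulr_suml.
by apply: eq_bigr => i _; rewrite !mxE.
Qed.

Lemma tensmx_sumr (I : finType) m1 n1 m2 n2 (A : I -> 'M[K]_(m1, n1)) (E : 'M[K]_(m2, n2)) :
  E *t (\sum_i A i) = \sum_i E *t A i.
Proof.
apply/matrixP => x y; rewrite !mxE !summxE mulr_sumr.
by apply: eq_bigr => i _; rewrite !mxE.
Qed.

Lemma invmx_tens : invmx (Ta *t Tb) = invmx Ta *t invmx Tb.
Proof.
by rewrite -[RHS](mulKmx TU) TV mulmx1.
Qed.

Lemma tensor_bracket : gl_bracket h tensor_letter.
Proof.
have iotaE (X : tensor_trace) : st_iota tensor_trace h * X = h *: (X : 'M[K]_(p * q)) :> 'M_(p * q).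
  exact: (mul_scalar_mx h (X : 'M[K]_(p * q))).
have mulE (X Y : tensor_trace) : X * Y = (X : 'M[K]_(p * q)) *m Y by [].
case=> [] [] i j k l; rewrite /= ?iotaE !mulE !mxE !tensmx_mul ?mul1mx ?mulmx1 ?subrr //.
  rewrite -tensmxBl a_bracket tensmxZl tensmxBl; congr (_ *: (_ - _)); by case: ifP => // _; rewrite ?tens0mx.
rewrite -tensmxBr b_bracket tensmxZr tensmxBr; congr (_ *: (_ - _)); by case: ifP => // _; rewrite ?tensmx0.
Qed.

Lemma tensor_letter_star c : st_star (mat_star_trace tensor_trace n) (tensor_letter c) = tensor_letter c.
Proof.
apply/matrixP => i j; rewrite mxE; apply: base_star_eq => //; rewrite invmx_tens.
case: c; rewrite !mxE !tensmx_mul trmx_tens map_mxT ?mulmx1 mulmxV //.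
  by rewrite a_adj trmx1 map_mx1.
by rewrite b_adj trmx1 map_mx1.
Qed.

Lemma tensor_letter_pow c k i j : (tensor_letter c ^+ k) i j =
  (if c then (a ^+ k) i j *t 1%:M else 1%:M *t (b ^+ k) i j) :> 'M_(p * q).
Proof.
elim: k i j => [|k IHk] i j.
  rewrite !expr0 !mxE; case: (i == j); first by case: c; rewrite tensmx11.
  by case: c; rewrite ?tens0mx ?tensmx0.
rewrite exprS mxE; case: c IHk => IHk.
  rewrite exprS mxE tensmx_suml; apply: eq_bigr => m _; rewrite IHk mxE.
  by rewrite -[LHS]/(_ *m _) tensmx_mul mulmx1.
rewrite exprS mxE tensmx_sumr; apply: eq_bigr => m _; rewrite IHk mxE.
by rewrite -[LHS]/(_ *m _) tensmx_mul mulmx1.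
Qed.

Lemma tensor_letter_pure c k : ptr ((tensor_letter c : mat_star_trace tensor_trace n) ^+ k) =
  st_iota tensor_trace (if c then s k else t k).
Proof.
rewrite /ptr (eq_bigr _ (fun i _ => tensor_letter_pow c k i i)).
have scalE (x : K) : (x%:M : 'M[K]_p) *t (1%:M : 'M[K]_q) = x%:M.
  have -> : (x%:M : 'M[K]_p) = x *: 1%:M by rewrite scalemx1.
  by rewrite tensmxZl tensmx11 scalemx1.
have scalE' (x : K) : (1%:M : 'M[K]_p) *t (x%:M : 'M[K]_q) = x%:M.
  have -> : (x%:M : 'M[K]_q) = x *: 1%:M by rewrite scalemx1.
  by rewrite tensmxZr tensmx11 scalemx1.
have N0 : n.+1%:R != 0 :> K by rewrite pnatr_eq0.
case: c.
  rewrite -tensmx_suml a_trace scalE.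
  by rewrite -[LHS]/((n.+1%:R^-1)%:M *m (n.+1%:R * s k)%:M) -scalar_mxM mulKf.
rewrite -tensmx_sumr b_trace scalE'.
by rewrite -[LHS]/((n.+1%:R^-1)%:M *m (n.+1%:R * t k)%:M) -scalar_mxM mulKf.
Qed.
End TensorModel.

(** * Polynomial models of rational representations *)

Module PolynomialAction.
Import mpoly.

Lemma poly_vanishing (K : numFieldType) (p : {poly K}) :
  (forall h, p.[h] = 0) -> p = 0.
Proof.
move=> p0; apply/eqP; apply/negPn/negP => pn0.
have := @max_poly_roots K p [seq i%:R | i <- iota 0 (size p)] pn0.
have -> : all (root p) [seq i%:R | i <- iota 0 (size p)] by apply/allP => x _; apply/rootP.
rewrite map_inj_uniq ?iota_uniq ?size_map ?size_iota ?ltnn => [/(_ isT isT)//|i j /eqP].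
by rewrite eqr_nat => /eqP.
Qed.

Section Mpoly.
Variables (K : numFieldType) (n : nat).
Implicit Types (P Q : {mpoly K[n]}) (x y : 'I_n -> K).

Lemma mpoly_ring_ind (F : {mpoly K[n]} -> Prop) :
  (forall c, F c%:MP) -> (forall i, F 'X_i) ->
  (forall P Q, F P -> F Q -> F (P + Q)) -> (forall P Q, F P -> F Q -> F (P * Q)) ->
  forall P, F P.
Proof.
move=> FC FX FD FM; apply: mpolyind => [|c m P _ _ FP]; first by rewrite -mpolyC0.
apply: FD => //; rewrite -mul_mpolyC; apply: (FM) => //; rewrite mpolyXE_id.
apply: big_ind => [||i _]; [by rewrite -mpolyC1 | exact: FM |].
by elim: (m i) => [|k IHk]; rewrite ?expr0 -?mpolyC1 // exprS; apply: FM.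
Qed.

Definition dirderiv P x y : K := \sum_k y k * (P^`M(k)).@[x].

(** First-order identities can then be proved by comparing linear coefficients of univariate
    polynomials, without any analysis. *)
Lemma line_expansion P x y : exists p : {poly K},
  [/\ forall h, P.@[fun k => x k + h * y k] = p.[h], p`_0 = P.@[x] & p`_1 = dirderiv P x y].
Proof.
rewrite /dirderiv; move: P; apply: mpoly_ring_ind => [c|i|P Q [p [pe p0 p1]] [q [qe q0 q1]]|P Q [p [pe p0 p1]] [q [qe q0 q1]]].
- exists c%:P; split=> [h||]; rewrite ?mevalC ?hornerC ?coefC //=.
  by rewrite big1 // => k _; rewrite mderivC meval0 mulr0.
- exists ((x i)%:P + (y i)%:P * 'X); split=> [h||].
  + by rewrite mevalXU !hornerE mulrC.
  + by rewrite coefD coefC coefMX mevalXU addr0.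
  + rewrite coefD coefC coefMX coefC add0r (bigD1 i) //= big1 ?addr0 => [|k ki].
      by rewrite mderivX mnm1E eqxx scale1r -[X in (X - _)%MM]add0m addmK mpolyX0 meval1 mulr1.
    by rewrite mderivX mnm1E eq_sym (negPf ki) scale0r meval0 mulr0.
- exists (p + q); split=> [h||]; rewrite ?mevalD ?hornerD ?coefD ?pe ?qe ?p0 ?q0 ?p1 ?q1 //.
  by rewrite -big_split; apply: eq_bigr => k _; rewrite mderivD mevalD mulrDr.
- exists (p * q); split=> [h||]; rewrite ?mevalM ?hornerM ?pe ?qe ?coef0M ?p0 ?q0 //.
  rewrite coefM !big_ord_recl big_ord0 /= /bump /= subn0 p0 p1 q0 q1 addr0.
  rewrite [X in X + _]mulr_sumr [X in _ + X]mulr_suml -big_split; apply: eq_bigr => k _ /=.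
  by rewrite mderivM mevalD !mevalM; ring.
Qed.

Lemma mderiv_vanishing P i : (forall x, P.@[x] = 0) -> forall x, (P^`M(i)).@[x] = 0.
Proof.
move=> P0 x; have [p [pe _ p1]] := line_expansion P x (fun k => (k == i)%:R).
have pz : p = 0 by apply: poly_vanishing => h; rewrite -pe.
move: p1; rewrite pz coef0 /dirderiv (bigD1 i) //= eqxx mul1r big1 ?addr0 // => k /negPf ->.
by rewrite mul0r.
Qed.

(** Partial derivatives of a vanishing function vanish. Differentiating lowers the degree of the
    monomial whose coefficient is sought, down to the constant coefficient, which is the value at
    0. *)
Lemma mpoly_vanishing P : (forall x, P.@[x] = 0) -> P = 0.
Proof.
move=> P0.
apply/mpolyP => m; rewrite mcoeff0.
have [d] := ubnP (mdeg m); elim: d m P P0 => // d IHd m P P0; rewrite ltnS => md.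
have [i mi|m0] := pickP (fun i => m i != 0%N).
  have mE : m = (m - U_(i) + U_(i))%MM by rewrite submK // lep1mP.
  have := IHd (m - U_(i))%MM P^`M(i) (mderiv_vanishing i P0).
  rewrite mcoeff_mderiv -mE => H; apply/eqP; rewrite -[_ == 0](mulrn_eq0 _ (m i - U_(i)%MM i).+1) -mnmBE H //.
  by rewrite {1}mE mdegD mdeg1 addn1 in md.
have -> : m = 0%MM by apply/mnmP => i; rewrite mnm0E; apply/eqP; have := m0 i => /negbFE.
rewrite -(P0 (fun=> 0)) mevalE [in LHS](mpolyE P) raddf_sum; apply: eq_bigr => k _ /=.
rewrite mcoeffZ mcoeffX; congr (_ * _); case: eqP => [->|k0].
  by rewrite big1 // => i _; rewrite mnm0E expr0.
have [i ki|ki] := pickP (fun i => k i != 0%N).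
  by rewrite (bigD1 i) //= expr0n (negPf ki) mul0r.
by case: k0; apply/mnmP => i; rewrite mnm0E; apply/eqP; have := ki i => /negbFE.
Qed.

End Mpoly.

(** * The Fischer inner product on polynomials *)

Section Fischer.
Variables (K : numClosedFieldType) (n : nat).
Implicit Types (P Q : {mpoly K[n]}).

Definition multinom_fact (m : 'X_{1..n}) : nat := (\prod_i (m i)`!)%N.

Lemma multinom_factU m i : multinom_fact (m + U_(i))%MM = ((m i).+1 * multinom_fact m)%N.
Proof.
rewrite /multinom_fact (bigD1 i) //= [in RHS](bigD1 i) //= mulnA -factS mnmDE mnm1E eqxx addn1.
by congr (_ * _)%N; apply: eq_bigr => j /negPf ji; rewrite mnmDE mnm1E eq_sym ji addn0.
Qed.

(** This is the value at 0 of Q differentiated by the operator obtained from the conjugate of P by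
    replacing variables with derivatives. It makes multiplication by a variable adjoint to
    differentiation. *)
Definition fischer P Q : K :=
  \sum_(m <- msupp P) (P@_m)^* * (multinom_fact m)%:R * Q@_m.

Lemma fischer_supp P Q (s : seq 'X_{1..n}) : uniq s -> {subset msupp P <= s} ->
  fischer P Q = \sum_(m <- s) (P@_m)^* * (multinom_fact m)%:R * Q@_m.
Proof.
move=> us Ps; rewrite [RHS](bigID (fun m => m \in msupp P)) /= [X in _ + X]big1 ?addr0; last first.
  by move=> m /memN_msupp_eq0 ->; rewrite conjC0 !mul0r.
rewrite -big_filter; apply: perm_big; apply: uniq_perm; rewrite ?filter_uniq // => m.
by rewrite mem_filter; case: (boolP (m \in msupp P)) => //= /Ps ->.
Qed.

Lemma fischer_conj P Q : fischer Q P = (fischer P Q)^*.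
Proof.
pose s := undup (msupp P ++ msupp Q).
have us : uniq s by exact: undup_uniq.
rewrite (@fischer_supp P Q s) ?(@fischer_supp Q P s) //; first last.
- by move=> m mP; rewrite mem_undup mem_cat mP.
- by move=> m mP; rewrite mem_undup mem_cat mP orbT.
rewrite rmorph_sum; apply: eq_bigr => m _.
by rewrite !rmorphM /= conjCK conjC_nat; ring.
Qed.

Fact fischer_is_zmod_morphism P : zmod_morphism (fischer P).
Proof.
by move=> Q Q'; rewrite /fischer -sumrB; apply: eq_bigr => m _; rewrite mcoeffB mulrBr.
Qed.
HB.instance Definition _ P := GRing.isZmodMorphism.Build _ _ (fischer P) (fischer_is_zmod_morphism P).

Lemma fischer_sumr P (I : finType) (Q : I -> {mpoly K[n]}) :
  fischer P (\sum_i Q i) = \sum_i fischer P (Q i).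
Proof. exact: raddf_sum. Qed.

Lemma fischer_suml P (I : finType) (Q : I -> {mpoly K[n]}) :
  fischer (\sum_i Q i) P = \sum_i fischer (Q i) P.
Proof.
rewrite fischer_conj fischer_sumr rmorph_sum; apply: eq_bigr => i _.
by rewrite [RHS]fischer_conj.
Qed.

Lemma fischerZr P c Q : fischer P (c *: Q) = c * fischer P Q.
Proof. by rewrite mulr_sumr; apply: eq_bigr => m _; rewrite mcoeffZ mulrCA. Qed.

Lemma fischerZl P c Q : fischer (c *: P) Q = c^* * fischer P Q.
Proof. by rewrite fischer_conj fischerZr rmorphM /= -fischer_conj. Qed.

Lemma fischer_mulX P Q i : fischer (P * 'X_i) Q = fischer P (Q^`M(i)).
Proof.
rewrite /fischer (perm_big _ (msuppMX P U_(i)%MM)) big_map /=.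
apply: eq_bigr => m _; rewrite mcoeffMX addmC mcoeff_mderiv multinom_factU.
by rewrite natrM -[_ *+ (m i).+1]mulr_natl; ring.
Qed.

Lemma fischer_mderiv P Q i : fischer (P^`M(i)) Q = fischer P (Q * 'X_i).
Proof. by rewrite fischer_conj -fischer_mulX -fischer_conj. Qed.
End Fischer.

Lemma mxvec_index_eq m n (i k : 'I_m) (j l : 'I_n) :
  (mxvec_index i j == mxvec_index k l) = (i == k) && (j == l).
Proof.
by rewrite /mxvec_index (inj_eq (@cast_ord_inj _ _ _)) (inj_eq enum_rank_inj).
Qed.

Lemma sum_mxvec_index (V : nmodType) m n (F : 'I_(m * n) -> V) :
  \sum_k F k = \sum_i \sum_j F (mxvec_index i j).
Proof.
by rewrite pair_big /= (reindex _ (curry_mxvec_bij m n)) /=; apply: eq_bigr => -[].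
Qed.

Section MatrixPolynomials.
Variables (K : numFieldType) (N : nat).
Implicit Types (P : {mpoly K[N * N]}) (g X : 'M[K]_N).

Definition mxeval P g : K := P.@[fun k => mxvec g 0 k].
Lemma mxeval0 g : mxeval 0 g = 0.
Proof. exact: meval0. Qed.

Definition mxderiv P g X : K := dirderiv P (fun k => mxvec g 0 k) (fun k => mxvec X 0 k).

Lemma mxderivE P g X :
  mxderiv P g X = \sum_i \sum_j X i j * mxeval P^`M(mxvec_index i j) g.
Proof.
rewrite /mxderiv /dirderiv sum_mxvec_index.
by apply: eq_bigr => i _; apply: eq_bigr => j _; rewrite mxvecE.
Qed.

Lemma mxderiv_sum P g (X : 'M[K]_N) :
  mxderiv P g X = \sum_i \sum_j X i j * mxderiv P g (delta_mx i j).
Proof.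
rewrite mxderivE; apply: eq_bigr => i _; apply: eq_bigr => j _; congr (_ * _).
rewrite mxderivE (bigD1 i) //= [X in _ + X]big1 ?addr0 => [|k /negPf ki].
  rewrite (bigD1 j) //= big1 ?addr0 ?mxE ?eqxx ?mul1r // => k /negPf kj.
  by rewrite mxE kj andbF mul0r.
by rewrite big1 // => l _; rewrite mxE ki mul0r.
Qed.

Lemma mxline_expansion P g X : exists p : {poly K},
  [/\ forall h, mxeval P (g + h *: X) = p.[h], p`_0 = mxeval P g & p`_1 = mxderiv P g X].
Proof.
have [p [pe p0 p1]] := line_expansion P (fun k => mxvec g 0 k) (fun k => mxvec X 0 k).
exists p; split=> // h; rewrite -pe; apply: meval_eq => k.
by rewrite linearD linearZ !mxE.
Qed.

Definition det_mpoly : {mpoly K[N * N]} :=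
  \det (\matrix_(i, j) ('X_(mxvec_index i j) : {mpoly K[N * N]})).

Lemma mxeval_det g : mxeval det_mpoly g = \det g.
Proof.
rewrite /mxeval /det_mpoly -[LHS]/((meval (fun k => mxvec g 0 k)) _) -det_map_mx.
by congr (\det _); apply/matrixP => i j; rewrite !mxE; exact: etrans (mevalXU _ _) (mxvecE _ _ _).
Qed.

Lemma mxeval_vanishing P : (forall g, g \in unitmx -> mxeval P g = 0) -> P = 0.
Proof.
move=> P0; have det0 : det_mpoly != 0.
  by apply/eqP => d0; have := mxeval_det 1%:M; rewrite d0 /mxeval meval0 det1 => /esym/eqP; rewrite oner_eq0.
have : det_mpoly * P = 0.
  apply: mpoly_vanishing => x; pose g : 'M[K]_N := vec_mx (\row_k x k).
  have xg : x =1 (fun k => mxvec g 0 k) by move=> k; rewrite vec_mxK mxE.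
  rewrite (meval_eq _ xg) mevalM -!/(mxeval _ _) mxeval_det.
  have [/P0->|] := boolP (g \in unitmx); first by rewrite mulr0.
  by rewrite unitmxE unitfE negbK => /eqP->; rewrite mul0r.
by move/eqP; rewrite mulf_eq0 (negPf det0) => /eqP.
Qed.

(** The infinitesimal right translation by the matrix unit E_ij; under [fischer] its adjoint is the
    one by E_ji. *)
Definition polarization i j P : {mpoly K[N * N]} :=
  \sum_k P^`M(mxvec_index k j) * 'X_(mxvec_index k i).

Lemma polarization_sumZ i j (I : finType) (c : I -> K) (P : I -> {mpoly K[N * N]}) :
  polarization i j (\sum_a c a *: P a) = \sum_a c a *: polarization i j (P a).
Proof.
rewrite /polarization; under [RHS]eq_bigr do rewrite scaler_sumr.
rewrite exchange_big; apply: eq_bigr => k _ /=; rewrite raddf_sum mulr_suml.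
by apply: eq_bigr => a _; rewrite /= mderivZ scalerAl.
Qed.

Lemma mxeval_polarization i j P g : mxeval (polarization i j P) g = mxderiv P g (g *m delta_mx i j).
Proof.
rewrite /mxeval raddf_sum mxderivE; apply: eq_bigr => k _ /=.
rewrite mevalM mevalXU mxvecE (bigD1 j) //= big1 ?addr0 => [|l /negPf lj].
  rewrite mulrC; congr (_ * _); rewrite mxE (bigD1 i) //= big1 ?addr0 ?mxE ?eqxx ?mulr1 //.
  by move=> l /negPf li; rewrite mxE li mulr0.
by rewrite mxE big1 ?mul0r // => m _; rewrite mxE lj andbF mulr0.
Qed.

Lemma mderivXU (u v : 'I_(N * N)) : ('X_v : {mpoly K[N * N]})^`M(u) = (v == u)%:R.
Proof.
rewrite mderivX mnm1E; case: eqP => [->|_]; last by rewrite scale0r.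
by rewrite scale1r -[X in (X - _)%MM]add0m addmK mpolyX0.
Qed.

(** A composite of two such operators is a second-order part [S], symmetric under exchange of the
    two, plus a first-order part. Only the latter survives in the commutator. *)
Lemma polarization_bracket i j k l P : polarization i j (polarization k l P) - polarization k l (polarization i j P) =
  (if j == k then polarization i l P else 0) - (if i == l then polarization k j P else 0).
Proof.
pose S i j k l := \sum_a \sum_b P^`M(mxvec_index b l)^`M(mxvec_index a j) *
  'X_(mxvec_index b k) * 'X_(mxvec_index a i).
have E i' j' k' l' : polarization i' j' (polarization k' l' P) =
    S i' j' k' l' + (if j' == k' then polarization i' l' P else 0).
  rewrite [polarization i' j' _]/polarization; have -> : (if j' == k' then polarization i' l' P else 0) =
     \sum_a (if j' == k' then P^`M(mxvec_index a l') * 'X_(mxvec_index a i') else 0).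
    by rewrite /polarization; case: eqP => // _; rewrite big1.
  rewrite -big_split; apply: eq_bigr => a _ /=.
  rewrite [polarization k' l' P]/polarization raddf_sum mulr_suml /=.
  under eq_bigr do rewrite mderivM mulrDl mderivXU mxvec_index_eq.
  rewrite big_split /=; congr (_ + _); rewrite (bigD1 a) //= big1 ?addr0 => [|b /negPf ba].
    by rewrite eqxx [k' == _]eq_sym; case: eqP => _; rewrite ?mulr1 // mulr0 mul0r.
  by rewrite ba mulr0 mul0r.
have SC : S i j k l = S k l i j.
  rewrite /S exchange_big; apply: eq_bigr => b _; apply: eq_bigr => a _.
  by rewrite mderiv_comm mulrAC.
by rewrite !E SC opprD addrACA subrr add0r [l == i]eq_sym.
Qed.
End MatrixPolynomials.

Lemma fischer_polarization (K : numClosedFieldType) N i j (P Q : {mpoly K[N * N]}) :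
  fischer (polarization i j P) Q = fischer P (polarization j i Q).
Proof.
rewrite fischer_suml fischer_sumr; apply: eq_bigr => k _.
by rewrite fischer_mulX fischer_mderiv.
Qed.

Lemma det_transvection (K : comNzRingType) N (i j : 'I_N) (h : K) :
  \det (1%:M + h *: delta_mx i j) = 1 + h * (i == j)%:R.
Proof.
wlog ji : i j / (j <= i)%N.
  move=> H; case: (leqP j i) => [/H//|/ltnW ij].
  by rewrite -det_tr linearD linearZ /= trmx1 trmx_delta H // eq_sym.
rewrite det_trig; last first.
  apply/is_trig_mxP => a b ab; rewrite !mxE; have -> : (a == b) = false by apply/eqP => e; rewrite e ltnn in ab.
  case: (a =P i) => [ai|_]; case: (b =P j) => [bj|_]; rewrite /= ?mulr0 ?addr0 //.
  by move: ab ji; rewrite ai bj; lia.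
rewrite (bigD1 i) //= big1 ?mulr1; first by rewrite !mxE !eqxx.
by move=> k /negPf ki; rewrite !mxE ki eqxx mulr0 addr0.
Qed.

Lemma mxderiv_det (K : numFieldType) N (i j : 'I_N) :
  mxderiv (det_mpoly K N) 1%:M (delta_mx i j) = (i == j)%:R.
Proof.
have [p [pe _ <-]] := mxline_expansion (det_mpoly K N) 1%:M (delta_mx i j).
have -> : p = 1 + (i == j)%:R *: 'X.
  apply/eqP; rewrite -subr_eq0; apply/eqP; apply: poly_vanishing => h.
  by rewrite hornerD hornerN -pe mxeval_det det_transvection !hornerE mulrC subrr.
by rewrite coefD coef1 coefZ coefX add0r mulr1.
Qed.


Lemma common_denominator_mpoly (K : numFieldType) N n (V : 'M[K]_N -> 'M[K]_n) :
  (forall k l, exists (P : {mpoly K[N * N]}) r, forall g, g \in unitmx ->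
     V g k l = mxeval P g / \det g ^+ r) ->
  exists (Q : 'I_n -> 'I_n -> {mpoly K[N * N]}) r, forall g, g \in unitmx ->
    forall k l, mxeval (Q k l) g = \det g ^+ r * V g k l.
Proof.
move=> VP; have H (kl : 'I_n * 'I_n) : exists P : {mpoly K[N * N]} * nat, forall g, g \in unitmx ->
    mxeval P.1 g = \det g ^+ P.2 * V g kl.1 kl.2.
  have [P [r Pr]] := VP kl.1 kl.2; exists (P, r) => g gU.
  by rewrite (Pr g gU) mulrC divfK // expf_neq0 // -unitfE -unitmxE.
have [P PP] := fin_all_exists H.
pose s := (\sum_kl (P kl).2)%N.
exists (fun k l => (P (k, l)).1 * det_mpoly K N ^+ (s - (P (k, l)).2)%N), s => g gU k l.
have detX m : mxeval (det_mpoly K N ^+ m) g = \det g ^+ m.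
  by rewrite /mxeval rmorphXn /= -/(mxeval _ _) mxeval_det.
rewrite /mxeval mevalM -!/(mxeval _ _) detX PP //=.
have le : ((P (k, l)).2 <= s)%N by rewrite /s (bigD1 (k, l)) //= leq_addr.
by rewrite -[in RHS](subnK le) exprD; ring.
Qed.

(** * Differential and invariant inner product of an irreducible rational representation *)

Section PolynomialRep.
Variables (K : numClosedFieldType) (N n : nat) (V : 'M[K]_N -> 'M[K]_n).
Hypothesis V1 : V 1%:M = 1%:M.
Hypothesis VM : forall g g', g \in unitmx -> g' \in unitmx -> V (g *m g') = V g *m V g'.
Variables (Q : 'I_n -> 'I_n -> {mpoly K[N * N]}) (r : nat).
Hypothesis VQ : forall g, g \in unitmx -> forall k l, mxeval (Q k l) g = \det g ^+ r * V g k l.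

Definition deriv_mx (X : 'M[K]_N) : 'M[K]_n := \matrix_(k, l) mxderiv (Q k l) 1%:M X.
Definition det_deriv (X : 'M[K]_N) : K := mxderiv (det_mpoly K N) 1%:M X.
(** The differential at 1 of V = det^(-r) Q computed by the product rule, in a purely algebraic
    form; [lie_action_rho] identifies it with the analytic derivative. *)
Definition rho (X : 'M[K]_N) : 'M[K]_n := deriv_mx X - (r%:R * det_deriv X)%:M.

Lemma unit_line (X : 'M[K]_N) : exists2 d : {poly K}, d != 0 & forall h, d.[h] != 0 -> 1%:M + h *: X \in unitmx.
Proof.
have [d [de d0 _]] := mxline_expansion (det_mpoly K N) 1%:M X.
exists d => [|h]; last by rewrite -de mxeval_det unitmxE unitfE.
by apply/eqP => dz; move: d0; rewrite dz coef0 mxeval_det det1 => /esym/eqP; rewrite oner_eq0.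
Qed.

Lemma poly_eq_off (d p q : {poly K}) : d != 0 -> (forall h, d.[h] != 0 -> p.[h] = q.[h]) -> p = q.
Proof.
move=> d0 pq; apply/eqP; rewrite -subr_eq0.
have : d * (p - q) = 0.
  apply: poly_vanishing => h; rewrite hornerM hornerD hornerN.
  by have [->|/pq->] := eqVneq d.[h] 0; rewrite ?mul0r // subrr mulr0.
by move/eqP; rewrite mulf_eq0 (negPf d0).
Qed.

(* First-order terms in [h] of [V (g (1 + h X)) = V g * V (1 + h X)]. *)
Lemma mxderiv_mulr g (X : 'M[K]_N) k m : g \in unitmx ->
  mxderiv (Q k m) g (g *m X) = \sum_l mxeval (Q k l) g * deriv_mx X l m.
Proof.
move=> gU; have [d d0 dU] := unit_line X.
have [p [pe _ <-]] := mxline_expansion (Q k m) g (g *m X).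
have [f fP] := fin_all_exists (fun l => mxline_expansion (Q l m) 1%:M X).
have -> : p = \sum_l (mxeval (Q k l) g)%:P * f l.
  apply: (poly_eq_off d0) => h /dU hU; rewrite -pe horner_sum.
  have -> : g + h *: (g *m X) = g *m (1%:M + h *: X) by rewrite mulmxDr mulmx1 scalemxAr.
  rewrite VQ ?unitmx_mul ?gU // det_mulmx VM // mxE mulr_sumr; apply: eq_bigr => l _.
  have [fe _ _] := fP l.
  by rewrite hornerM hornerC -fe !VQ // exprMn; ring.
rewrite coef_sum; apply: eq_bigr => l _; have [_ _ f1] := fP l.
by rewrite coefCM f1 mxE.
Qed.

Lemma mxderiv_mull g (X : 'M[K]_N) k m : g \in unitmx ->
  mxderiv (Q k m) g (X *m g) = \sum_l deriv_mx X k l * mxeval (Q l m) g.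
Proof.
move=> gU; have [d d0 dU] := unit_line X.
have [p [pe _ <-]] := mxline_expansion (Q k m) g (X *m g).
have [f fP] := fin_all_exists (fun l => mxline_expansion (Q k l) 1%:M X).
have -> : p = \sum_l (mxeval (Q l m) g)%:P * f l.
  apply: (poly_eq_off d0) => h /dU hU; rewrite -pe horner_sum.
  have -> : g + h *: (X *m g) = (1%:M + h *: X) *m g by rewrite mulmxDl mul1mx scalemxAl.
  rewrite VQ ?unitmx_mul ?gU ?andbT // det_mulmx VM // mxE mulr_sumr; apply: eq_bigr => l _.
  have [fe _ _] := fP l.
  by rewrite hornerM hornerC -fe !VQ // exprMn; ring.
rewrite coef_sum; apply: eq_bigr => l _; have [_ _ f1] := fP l.
by rewrite coefCM f1 mxE mulrC.
Qed.

Lemma det_deriv_conj g (X : 'M[K]_N) : g \in unitmx -> det_deriv (g *m X *m invmx g) = det_deriv X.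
Proof.
move=> gU; have [p [pe _ p1]] := mxline_expansion (det_mpoly K N) 1%:M X.
have [q [qe _ q1]] := mxline_expansion (det_mpoly K N) 1%:M (g *m X *m invmx g).
rewrite /det_deriv -p1 -q1; congr (_`_1); congr polyseq; apply/eqP; rewrite -subr_eq0; apply/eqP.
apply: poly_vanishing => h; rewrite hornerD hornerN -pe -qe !mxeval_det.
have -> : 1%:M + h *: (g *m X *m invmx g) = g *m (1%:M + h *: X) *m invmx g.
  by rewrite mulmxDr mulmxDl mulmx1 mulmxV // -scalemxAr -scalemxAl.
by rewrite !det_mulmx mulrAC -det_mulmx mulmxV // det1 mul1r subrr.
Qed.

Lemma det_pow_neq0 (g : 'M[K]_N) : g \in unitmx -> \det g ^+ r != 0.
Proof. by move=> gU; rewrite expf_neq0 // -unitfE -unitmxE. Qed.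

(** Since g X = (g X g^-1) g, both sides compute the same derivative of Q at g, once by right and
    once by left multiplication. *)
Lemma rho_conj g X : g \in unitmx -> V g *m rho X = rho (g *m X *m invmx g) *m V g.
Proof.
move=> gU; have dg0 := det_pow_neq0 gU.
have QV : (\matrix_(k, l) mxeval (Q k l) g) = \det g ^+ r *: V g.
  by apply/matrixP => k l; rewrite !mxE VQ.
rewrite /rho det_deriv_conj // mulmxBr mulmxBl mul_mx_scalar mul_scalar_mx; congr (_ - _).
apply: (scalerI dg0); rewrite scalemxAl scalemxAr -QV.
apply/matrixP => k m; rewrite [LHS]mxE [RHS]mxE.
under eq_bigr do rewrite mxE; under [RHS]eq_bigr do rewrite [X in _ * X]mxE.
by rewrite -mxderiv_mulr // -mxderiv_mull // mulmxKV.
Qed.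

Lemma rho_sum X : rho X = \sum_i \sum_j X i j *: rho (delta_mx i j).
Proof.
apply/matrixP => k l; rewrite summxE.
under eq_bigr do rewrite summxE.
under eq_bigr do under eq_bigr do rewrite mxE.
rewrite !mxE {1}mxderiv_sum /det_deriv [X in (_ * X) *+ _]mxderiv_sum.
rewrite mulr_sumr -sumrMnl -sumrB; apply: eq_bigr => i _.
rewrite mulr_sumr -sumrMnl -sumrB; apply: eq_bigr => j _.
by rewrite !mxE mulrBr mulrnAr mulrCA.
Qed.

Hypothesis n_gt0 : (0 < n)%N.
Hypothesis V_irr : forall U : {vspace 'cV[K]_n},
  (forall g, g \in unitmx -> forall v, v \in U -> V g *m v \in U) -> U = 0%VS \/ U = fullv.

Definition col_ker m (A : 'M[K]_(m, n)) : {vspace 'cV[K]_n} := lker (linfun (mulmx A)).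

Lemma memv_col_ker m (A : 'M[K]_(m, n)) (v : 'cV[K]_n) :
  (v \in col_ker A) = (A *m v == 0).
Proof. by rewrite memv_ker lfunE. Qed.

Lemma schur_scalar (A : 'M[K]_n) : (forall g, g \in unitmx -> V g *m A = A *m V g) ->
  exists c, A = c%:M.
Proof.
move=> AV.
have [c /eigenvalueP[w wA w0]] := eigenvalue_closed A^T n_gt0.
exists c; apply/eqP; rewrite -subr_eq0.
have Aw : (A - c%:M) *m w^T = 0.
  by rewrite mulmxBl mul_scalar_mx -[A]trmxK -trmx_mul wA linearZ subrr.
have [g gU v|U0|Uf] := V_irr (U := col_ker (A - c%:M)).
- rewrite !memv_col_ker mulmxA => /eqP Av.
  by rewrite mulmxBl -AV // mul_scalar_mx -mul_mx_scalar -mulmxBr -mulmxA Av mulmx0.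
- have : w^T \in col_ker (A - c%:M) by rewrite memv_col_ker Aw.
  by rewrite U0 memv0 trmx_eq0 (negPf w0).
apply/eqP/matrixP => i j; have : delta_mx j 0 \in col_ker (A - c%:M) by rewrite Uf memvf.
rewrite memv_col_ker => /eqP/matrixP/(_ i 0); rewrite -colE [LHS]mxE.
by rewrite [RHS]mxE => ->; rewrite mxE.
Qed.

Let k0 := Ordinal n_gt0.
(* [det g ^ r * (V g v)_k0] as a polynomial in the entries of [g]; on these
   polynomials [gl_N] acts by the polarization operators, shifted by [- r tr]. *)
Definition orbit_poly (v : 'cV[K]_n) : {mpoly K[N * N]} := \sum_l v l 0 *: Q k0 l.

Lemma mxeval_orbit_poly v g : g \in unitmx ->
  mxeval (orbit_poly v) g = \det g ^+ r * (V g *m v) k0 0.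
Proof.
move=> gU; rewrite /mxeval raddf_sum mxE mulr_sumr; apply: eq_bigr => l _ /=.
by rewrite mevalZ -/(mxeval _ _) VQ //; ring.
Qed.

Definition orbit_supp := undup (flatten [seq (msupp (Q k0 l) : seq _) | l <- enum 'I_n]).

(** The coefficients of [orbit_poly] as a linear map of the vector. The square roots of the
    factorials turn the Fischer product into the standard Hermitian one, whence [gramE]. *)
Definition orbit_coef : 'M[K]_(size orbit_supp, n) :=
  \matrix_(t, l) (sqrtC (multinom_fact (nth 0%MM orbit_supp t))%:R * (Q k0 l)@_(nth 0%MM orbit_supp t)).

Lemma orbit_suppP l m : m \in msupp (Q k0 l) -> m \in orbit_supp.
Proof.
move=> mQ; rewrite mem_undup; apply/flattenP; exists (msupp (Q k0 l)) => //.
by apply/mapP; exists l; rewrite ?mem_enum.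
Qed.

Lemma multinom_fact_neq0 k (m : 'X_{1..k}) : (multinom_fact m)%:R != 0 :> K.
Proof. by rewrite pnatr_eq0 -lt0n prodn_gt0 // => i; rewrite fact_gt0. Qed.

Lemma orbit_coef_eq0 (v : 'cV[K]_n) : (orbit_coef *m v == 0) = (orbit_poly v == 0).
Proof.
have coefE m : (orbit_poly v)@_m = \sum_l (Q k0 l)@_m * v l 0.
  by rewrite raddf_sum; apply: eq_bigr => l _ /=; rewrite mcoeffZ mulrC.
apply/eqP/eqP => [Jv|v0].
  apply/mpolyP => m; rewrite mcoeff0.
  have [mS|mS] := boolP (m \in orbit_supp); last first.
    rewrite coefE big1 // => l _; rewrite memN_msupp_eq0 ?mul0r //.
    by apply: contra mS; apply: orbit_suppP.
  have mi : (index m orbit_supp < size orbit_supp)%N by rewrite index_mem.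
  move/matrixP/(_ (Ordinal mi) 0): Jv; rewrite !mxE.
  under eq_bigr do rewrite mxE /= nth_index // -mulrA.
  rewrite -mulr_sumr -coefE => /eqP; rewrite mulf_eq0 sqrtC_eq0.
  by rewrite (negPf (multinom_fact_neq0 _)) => /eqP.
apply/matrixP => t j; rewrite ord1 !mxE.
under eq_bigr do rewrite mxE -mulrA.
by rewrite -mulr_sumr -coefE v0 mcoeff0 mulr0.
Qed.

(** The kernel is stable under the group, because translating the argument of a zero polynomial
    gives zero. It is not the whole space: at g = 1 the polynomial of the basis vector [k0] takes
    the value 1. Irreducibility leaves only 0. *)
Lemma orbit_coef_inj (v : 'cV[K]_n) : orbit_coef *m v = 0 -> v = 0.
Proof.
move=> Jv; have [g gU u|U0|Uf] := V_irr (U := col_ker orbit_coef).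
- rewrite !memv_col_ker !orbit_coef_eq0 => /eqP u0; apply/eqP; apply: mxeval_vanishing => h hU.
  have hgU : h *m g \in unitmx by rewrite unitmx_mul hU.
  have := mxeval_orbit_poly u hgU; rewrite u0 mxeval0 => /esym/eqP.
  rewrite mulf_eq0 (negPf (det_pow_neq0 hgU)) VM // => /eqP e.
  by rewrite mxeval_orbit_poly // mulmxA e mulr0.
- by apply/eqP; rewrite -memv0 -U0 memv_col_ker Jv.
have : delta_mx k0 0 \in col_ker orbit_coef by rewrite Uf memvf.
rewrite memv_col_ker orbit_coef_eq0 => /eqP e0.
have := mxeval_orbit_poly (delta_mx k0 0) (unitmx1 _ _); rewrite e0 mxeval0 V1 mul1mx det1 expr1n mul1r mxE !eqxx.
by move/eqP; rewrite eq_sym oner_eq0.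
Qed.

Lemma polarization_orbit (i j : 'I_N) m :
  polarization i j (Q k0 m) = \sum_l deriv_mx (delta_mx i j) l m *: Q k0 l.
Proof.
apply/eqP; rewrite -subr_eq0; apply/eqP; apply: mxeval_vanishing => g gU.
rewrite /mxeval mevalB -!/(mxeval _ _) mxeval_polarization mxderiv_mulr // [X in _ - X]raddf_sum /=.
by rewrite -sumrB big1 // => l _; rewrite mevalZ -/(mxeval _ _) mulrC subrr.
Qed.

Lemma rho_delta i j : rho (delta_mx i j) = deriv_mx (delta_mx i j) - (r%:R * (i == j)%:R)%:M.
Proof. by rewrite /rho /det_deriv mxderiv_det. Qed.

Definition gram : 'M[K]_n := \matrix_(l, m) fischer (Q k0 l) (Q k0 m).

Lemma gramE : gram = orbit_coef^H *m orbit_coef.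
Proof.
apply/matrixP => l m; rewrite !mxE.
rewrite (@fischer_supp _ _ _ _ orbit_supp) ?undup_uniq //; last by move=> ?; apply: orbit_suppP.
rewrite (big_nth 0%MM) big_mkord; apply: eq_bigr => t _; rewrite !mxE rmorphM /=.
have -> : (sqrtC (multinom_fact (nth 0%MM orbit_supp t))%:R)^* = sqrtC (multinom_fact (nth 0%MM orbit_supp t))%:R :> K.
  by rewrite geC0_conj // sqrtC_ge0 ler0n.
set a := sqrtC _; have -> : (multinom_fact (nth 0%MM orbit_supp t))%:R = a * a :> K by rewrite -expr2 sqrtCK.
by ring.
Qed.

Lemma deriv_mx_adjoint i j :
  (deriv_mx (delta_mx i j))^H *m gram = gram *m deriv_mx (delta_mx j i).
Proof.
apply/matrixP => l m; have := fischer_polarization i j (Q k0 l) (Q k0 m).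
rewrite !polarization_orbit fischer_suml fischer_sumr => e.
rewrite [LHS]mxE [RHS]mxE; etransitivity; [|etransitivity; [exact: e|]]; apply: eq_bigr => a _.
  by rewrite !mxE fischerZl.
by rewrite [gram _ _]mxE fischerZr mulrC.
Qed.

Lemma rho_adjoint i j : (rho (delta_mx i j))^H *m gram = gram *m rho (delta_mx j i).
Proof.
rewrite !rho_delta linearB /= map_mxB mulmxBl mulmxBr deriv_mx_adjoint; congr (_ - _).
rewrite tr_scalar_mx map_scalar_mx /= rmorphM !rmorph_nat mul_scalar_mx mul_mx_scalar.
by rewrite eq_sym.
Qed.

Lemma orbit_polyB v w : orbit_poly (v - w) = orbit_poly v - orbit_poly w.
Proof.
by rewrite /orbit_poly -sumrB; apply: eq_bigr => l _; rewrite !mxE scalerBl.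
Qed.

Lemma orbit_poly_inj v w : orbit_poly v = orbit_poly w -> v = w.
Proof.
move=> vw; apply/eqP; rewrite -subr_eq0; apply/eqP/orbit_coef_inj/eqP.
by rewrite orbit_coef_eq0 orbit_polyB vw subrr.
Qed.

Lemma polarization_egl i j k l m : polarization i j (polarization k l (Q k0 m)) =
  orbit_poly (col m (deriv_mx (delta_mx i j) *m deriv_mx (delta_mx k l))).
Proof.
rewrite polarization_orbit polarization_sumZ; under eq_bigr do rewrite polarization_orbit scaler_sumr.
rewrite exchange_big; apply: eq_bigr => b _ /=.
rewrite 2!mxE scaler_suml; apply: eq_bigr => a _.
by rewrite scalerA mulrC.
Qed.

(** [orbit_poly] intertwines these matrices with the polarization operators and is injective, so the
    bracket transfers. *)
Lemma deriv_mx_comm i j k l :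
  deriv_mx (delta_mx i j) *m deriv_mx (delta_mx k l) -
    deriv_mx (delta_mx k l) *m deriv_mx (delta_mx i j) =
  (if j == k then deriv_mx (delta_mx i l) else 0) -
    (if i == l then deriv_mx (delta_mx k j) else 0).
Proof.
have op_if (b : bool) a c m : orbit_poly (col m (if b then deriv_mx (delta_mx a c) else 0)) =
   if b then polarization a c (Q k0 m) else 0.
  case: b; rewrite ?polarization_orbit; first by apply: eq_bigr => x _; rewrite !mxE.
  by rewrite /orbit_poly big1 // => x _; rewrite !mxE scale0r.
have eq_col (A B : 'M[K]_n) : (forall m, col m A = col m B) -> A = B.
  by move=> AB; apply/matrixP => a m; move/matrixP/(_ a 0): (AB m); rewrite !mxE.
apply: eq_col => m; apply: orbit_poly_inj.
rewrite !linearB /= !orbit_polyB -!polarization_egl polarization_bracket.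
by rewrite !op_if.
Qed.

Lemma gl_comm i j k l :
  rho (delta_mx i j) *m rho (delta_mx k l) - rho (delta_mx k l) *m rho (delta_mx i j) =
  (if j == k then rho (delta_mx i l) else 0) - (if i == l then rho (delta_mx k j) else 0).
Proof.
have commB (A B : 'M[K]_n) a b :
    (A - a%:M) *m (B - b%:M) - (B - b%:M) *m (A - a%:M) = A *m B - B *m A.
  rewrite !mulmxBl !mulmxBr !mul_scalar_mx !mul_mx_scalar !scale_scalar_mx [b * a]mulrC.
  move: (A *m B) (B *m A) (b *: A) (a *: B) (a * b)%:M => x y z u w.
  by apply/matrixP => p q; rewrite !mxE; ring.
rewrite !rho_delta commB deriv_mx_comm.
(* Scalar shifts drop out of the commutator. On the right they are nonzero only if j = k and i = l
   hold together, and then they cancel. *)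
rewrite [k == j]eq_sym; case: (j == k); case: (i == l);
  by rewrite ?mulr0 ?raddf0 ?addr0 // ?opprB ?addrA ?subrK.
Qed.

(** [rho_adjoint] is self-adjointness for the Gram matrix, so an invertible square T with T^H T =
    [gram] is wanted. [orbit_coef] is such a root but rectangular; Gram-Schmidt on its columns
    factors off an isometry and leaves a square factor. *)
Lemma unitarizable : exists2 T : 'M[K]_n, T \in unitmx & forall i j,
  (T *m rho (delta_mx i j) *m invmx T)^H = T *m rho (delta_mx j i) *m invmx T.
Proof.
have rfJ : \rank orbit_coef^T = n.
  apply/eqP; rewrite -[_ == n]/(row_free _) -kermx_eq0; apply/eqP/row_matrixP => i.
  have : row i (kermx orbit_coef^T) *m orbit_coef^T = 0 by rewrite -row_mul mulmx_ker row0.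
  move=> /(congr1 trmx); rewrite trmx_mul trmxK trmx0 => /orbit_coef_inj/(congr1 trmx).
  by rewrite trmxK trmx0 row0.
have le_ns : (n <= size orbit_supp)%N by rewrite -{1}rfJ rank_leq_col.
have /unitarymxP UU := schmidt_unitarymx orbit_coef^T le_ns.
have /submxP[L JL] := schmidt_sub orbit_coef^T.
set U := schmidt _ in UU JL.
have UU' : (U^T)^H *m U^T = 1%:M.
  by apply: trmx_inj; rewrite trmx_mul !trmxK trmx1 map_trmx.
have gT : gram = (L^T)^H *m L^T.
  rewrite gramE -[orbit_coef]trmxK JL trmx_mul trmx_mul map_mxM /=.
  by rewrite mulmxA -[_ *m _ *m U^T]mulmxA UU' mulmx1.
have TU : L^T \in unitmx.
  rewrite unitmx_tr -row_free_unit /row_free eqn_leq rank_leq_row /= -{1}rfJ JL.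
  exact: mxrankM_maxl.
exists L^T => // i j; set T := L^T in gT TU *.
have := rho_adjoint i j; rewrite gT => e.
have iT : (invmx T)^H *m T^H = 1%:M.
  by rewrite -map_mxM -trmx_mul mulmxV // trmx1 map_mx1.
rewrite !trmx_mul !map_mxM /= -[LHS]mulmx1 -(mulmxV TU) !mulmxA -[_ *m T^H *m T]mulmxA.
by rewrite -[_ *m _^H *m (T^H *m T)]mulmxA e !mulmxA iT mul1mx.
Qed.
End PolynomialRep.

End PolynomialAction.
Import PolynomialAction.

From mathcomp Require Import all_classical all_reals all_analysis.
From mathcomp Require Import complex.
Import numFieldNormedType.Exports.
Local Open Scope classical_set_scope.

(** * Limits of joint moments *)

Section Determined.
Variables (C : numFieldType) (F : nat -> seq (seq bool) -> C).
Variables (m : nat -> bool -> nat -> C) (tau : seq bool -> C).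
Hypothesis F_nil : forall n, F n [::] = 1.
Hypothesis m0 : forall n b, m n b 0%N = 1.
Hypothesis tau_nil : tau [::] = 1.
Hypothesis F_pure : forall n b k Ws, F n (nseq k b :: Ws) = m n b k * F n Ws.
Hypothesis m_cvg : forall b k, (fun n => m n b k) @ \oo --> (tau (nseq k b) : C^o).
Hypothesis F_cyclic : forall v w Ws,
  (fun n => F n ((v ++ w) :: Ws) - F n ((w ++ v) :: Ws)) @ \oo --> (0 : C^o).
Hypothesis tau_cyclic : forall v w, tau (v ++ w) = tau (w ++ v).
Hypothesis F_loop : forall w Ws,
  (fun n => \sum_(0 <= s < size w | nth false w s)
     (F n [:: take s w, drop s w & Ws] - F n [:: take s.+1 w, drop s.+1 w & Ws]))
  @ \oo --> (0 : C^o).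
Hypothesis tau_loop : forall w, \sum_(0 <= s < size w | nth false w s)
    (tau (take s w) * tau (drop s w) - tau (take s.+1 w) * tau (drop s.+1 w)) = 0.

Let tau_prod (Ws : seq (seq bool)) := \prod_(w <- Ws) tau w.
Let D n Ws := F n Ws - tau_prod Ws.
Let null (u : nat -> C) := u @ \oo --> (0 : C^o).

Lemma null_eq (u v : nat -> C) : (forall n, u n = v n) -> null u -> null v.
Proof. by move=> uv; have -> : u = v by apply/funext. Qed.

Lemma nullD (u v : nat -> C) : null u -> null v -> null (fun n => u n + v n).
Proof. by move=> u0 v0; rewrite /null -[0](addr0 (0 : C^o)); apply: cvgD. Qed.

Lemma nullB (u v : nat -> C) : null u -> null v -> null (fun n => u n - v n).
Proof. by move=> u0 v0; rewrite /null -[0](subr0 (0 : C^o)); apply: cvgB. Qed.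

Lemma null_sum (u : nat -> nat -> C) k (P : pred nat) :
  (forall s, (s < k)%N -> P s -> null (fun n => u n s)) ->
  null (fun n => \sum_(0 <= s < k | P s) u n s).
Proof.
elim: k => [_|k IHk H].
  by apply: null_eq (cvg_cst _) => n; rewrite big_geq.
have H' : null (fun n => \sum_(0 <= s < k | P s) u n s) by apply: IHk => s sk; apply: H; apply: ltnW.
case: (boolP (P k)) => Pk.
  apply: null_eq (nullD H' (H k (ltnSn k) Pk)) => n.
  by rewrite [RHS]big_mkcond big_nat_recr //= Pk -big_mkcond.
by apply: null_eq H' => n; rewrite [RHS]big_mkcond big_nat_recr //= (negPf Pk) addr0 -big_mkcond.
Qed.

(** Chosen so that cutting a word into two nonempty pieces strictly lowers the total, while the
    empty word still counts, so that removing it also does. *)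
Let weight (w : seq bool) := if w is [::] then 1%N else (size w).*2.-1.
Let total_weight Ws := (\sum_(w <- Ws) weight w)%N.

(* Every word with both letters is cyclically equivalent to one of the form A .. B,
   for which the loop equation involves only that word and pairs of nonempty words. *)
Lemma rotate_mixed (w : seq bool) : true \in w -> false \in w ->
  exists u v t, w = u ++ v /\ v ++ u = true :: rcons t false.
Proof.
have descent : forall s, false \in s -> last true s = true -> exists p q, s = p ++ [:: false, true & q].
  elim=> // b s IHs; rewrite inE; case: (boolP (false \in s)) => [fs _|fs].
    case: s fs IHs => // c s fs IHs /= ls.
    by have [p [q ->]] := IHs fs ls; exists (b :: p), q.
  rewrite orbF => /eqP <-; case: s fs {IHs} => [|[] s] //= _ _.
  by exists [::], s.
case/lastP: w => [//|w' [] tw fw].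
  have [p [q wE]] := descent _ fw (last_rcons _ _ _).
  by exists (rcons p false), (true :: q), (q ++ p); rewrite wE cat_rcons /= rcons_cat.
have tw' : true \in w' by move: tw; rewrite mem_rcons inE.
case: w' tw' {tw fw} => [//|[] w'] tw'.
  by exists [::], (rcons (true :: w') false), w'; rewrite /= cats0.
have {tw'} /splitPr[p q] : true \in w' by move: tw'; rewrite inE.
have [||p1 [q1 e]] := descent (false :: rcons p true); rewrite ?inE ?eqxx //= ?last_rcons //.
exists (rcons p1 false), (true :: q1 ++ rcons q false), (q1 ++ q ++ false :: p1).
have -> : false :: rcons (p ++ true :: q) false = (false :: rcons p true) ++ rcons q false.
  by rewrite rcons_cat cat_cons cat_rcons.
rewrite e -!cats1 -!catA /=; split=> //.
by rewrite -!catA.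
Qed.

Lemma weight_cat u v : u != [::] -> v != [::] -> (weight u + weight v < weight (u ++ v))%N.
Proof. by case: u => // b u; case: v => // c v _ _; rewrite /weight /= size_cat /=; lia. Qed.

(** Convergence and asymptotic factorization are proved together: the loop equation trades one word
    for pairs of words, and the limit of such a pair is known only as a product. *)
Lemma joint_moments_null Ws : null (D^~ Ws).
Proof.
have [n] := ubnP (total_weight Ws); elim: n Ws => // n IHn [|w Ws]; rewrite ltnS => wn.
  by apply: null_eq (cvg_cst _) => k; rewrite /D F_nil /tau_prod big_nil subrr.
have w0 : (0 < weight w)%N by rewrite /weight; case: (w) => //= b t; rewrite doubleS.
have wWs : (total_weight Ws < n)%N.
  by apply: leq_trans wn; rewrite /total_weight big_cons -[X in (X < _)%N]add0n ltn_add2r.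
have cases : (exists b k, w = nseq k b) \/ (true \in w /\ false \in w).
  case: (boolP (true \in w)) => tw; case: (boolP (false \in w)) => fw; [by right| | |].
  + by left; exists true, (size w); apply/all_pred1P/allP => x; case: x => //; rewrite (negPf fw).
  + by left; exists false, (size w); apply/all_pred1P/allP => x; case: x => //; rewrite (negPf tw).
  + by left; exists false, (size w); apply/all_pred1P/allP => x; case: x => //; rewrite (negPf tw).
case: cases => [[b [k wE]]|[tw fw]].
- have IH := IHn _ wWs.
  have mF : (fun i => m i b k * F i Ws) @ \oo --> (tau (nseq k b) * tau_prod Ws : C^o).
    apply: cvgM; first exact: m_cvg.
    rewrite (_ : F^~ Ws = (fun i => D i Ws + tau_prod Ws)).
      by rewrite -[X in _ --> X](add0r (tau_prod Ws : C^o)); apply: cvgD => //; apply: cvg_cst.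
    by apply/funext => i; rewrite /D subrK.
  rewrite /null -(subrr (tau (nseq k b) * tau_prod Ws : C^o)).
  rewrite (_ : D^~ (w :: Ws) = fun i => m i b k * F i Ws - tau (nseq k b) * tau_prod Ws).
    by apply: cvgB => //; apply: cvg_cst.
  by apply/funext => i; rewrite /D wE F_pure /tau_prod big_cons.
- have [u [v [t [wE vE]]]] := rotate_mixed tw fw.
  suff : null (D^~ ((v ++ u) :: Ws)).
    move=> H; apply: null_eq (nullD (F_cyclic u v Ws) H) => i.
    by rewrite /D wE /tau_prod !big_cons (tau_cyclic u v) addrA subrK.
  rewrite vE; set W := true :: _.
  have sW : size W = size w by rewrite wE size_cat addnC -size_cat vE.
  have : null (fun i => \sum_(0 <= s < size W | nth false W s)
     (D i [:: take s W, drop s W & Ws] - D i [:: take s.+1 W, drop s.+1 W & Ws])).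
    apply: null_eq (F_loop W Ws) => i.
    have /(congr1 (fun z => z * tau_prod Ws)) := tau_loop W; rewrite mul0r mulr_suml => e.
    rewrite -[LHS]subr0 -[X in _ - X = _]e -sumrB; apply: eq_bigr => s _.
    by rewrite /D /tau_prod !big_cons; ring.
  (* The loop sum without its one term of full weight. The initial letter A (s = 0) contributes the
     pair of the empty word and W, which is the wanted moment, minus the pair of A and the rest,
     which stays in [R]. *)
  set R := fun i => \sum_(0 <= s < size W | nth false W s)
    (if s == 0%N then - D i [:: [:: true], rcons t false & Ws] else
     D i [:: take s W, drop s W & Ws] - D i [:: take s.+1 W, drop s.+1 W & Ws]).
  have IH x y : x ++ y = W -> x != [::] -> y != [::] -> null (fun i => D i [:: x, y & Ws]).
    move=> xy x0 y0; apply: IHn; apply: leq_trans wn.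
    rewrite /total_weight !big_cons addnA ltn_add2r; apply: leq_trans (weight_cat x0 y0) _.
    rewrite xy /weight; move: sW; rewrite /W; by case: (w) => //= c w' [->].
  have R0 : null R.
    apply: null_sum => s sW' Ws'; case: eqP => [_|/eqP s0].
      by rewrite /null -[X in _ --> X](oppr0 (C^o)); apply: cvgN; apply: IH => //; case: (t).
    (* W ends with B, so no letter A is last and the cut just after it leaves a nonempty right
       piece. *)
    have sl : (s.+1 < size W)%N.
      rewrite ltn_neqAle sW' andbT; apply/eqP => e; move: Ws'.
      by rewrite -[s]/(s.+1.-1) e /W nth_last /= last_rcons.
    have ne x : (0 < size x)%N -> x != [::] :> seq bool by case: x.
    apply: nullB; apply: IH; rewrite ?cat_take_drop //; apply: ne;
      rewrite ?size_take_min ?size_drop; move: sl s0; clear; move: (size W); lia.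
  move=> L0; apply: null_eq (nullB L0 R0) => i; rewrite /R -sumrB.
  rewrite big_mkcond big_nat_recl //= -big_mkcond /= big1 ?addr0; last first.
    by move=> s _; rewrite subrr.
  rewrite take0 drop0 opprK subrK /D; congr (_ - _).
    by rewrite (F_pure i true 0) m0 mul1r.
  by rewrite /tau_prod big_cons tau_nil mul1r.
Qed.
End Determined.

Lemma cvg_mx_entries (K : numFieldType) (T : Type) (F : set_system T) (FF : Filter F) m n
    (f : T -> 'M[K]_(m, n)) (M : 'M[K]_(m, n)) :
  (forall i j, (fun x => f x i j) @ F --> (M i j : K^o)) -> f @ F --> M.
Proof.
move=> fM A [P PM PA]; apply: (filterS (P := [set x | forall i j, P i j (f x i j)])).
  by move=> x Px; apply: PA.
apply: filter_forall => i; apply: filter_forall => j.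
exact: (fM i j (P i j) (PM i j)).
Qed.

Lemma cvg_horner (K : numFieldType) (F : set_system K) (FF : Filter F) (p : {poly K}) (x : K) :
  (h @[h --> F] --> (x : K^o)) -> p.[h] @[h --> F] --> (p.[x] : K^o).
Proof.
move=> Fx; elim/poly_ind: p => [|p c IHp].
  have -> : horner (0 : {poly K}) = cst 0 by apply/funext => h; rewrite horner0.
  exact: cvg_cst.
have -> : horner (p * 'X + c%:P) = (fun h => p.[h] * h + c) by apply/funext => h; rewrite !hornerE.
apply: cvgD; last exact: cvg_cst.
exact: cvgM.
Qed.

Lemma coef1_expr (K : comNzRingType) (p : {poly K}) r :
  p`_0 = 1 -> (p ^+ r)`_0 = 1 /\ (p ^+ r)`_1 = r%:R * p`_1.
Proof.
move=> p0; elim: r => [|r [IH0 IH1]]; first by rewrite expr0 !coef1 mul0r.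
rewrite exprS coef0M p0 IH0 mulr1; split=> //.
rewrite coefM !big_ord_recl big_ord0 /= /bump /= subn0 IH0 IH1 p0.
by rewrite -[r.+1]addn1 natrD; ring.
Qed.

(** * The analytic differential, and its action on a highest weight vector *)

Section RationalRep.
Variables (K : numClosedFieldType) (N : nat) (V : rational_rep K N).
Local Notation n := (rep_dim V).

Lemma common_denominator : exists (Q : 'I_n -> 'I_n -> mpoly.mpoly (N * N) K) (r : nat),
  forall g, g \in unitmx -> forall k l, mxeval (Q k l) g = \det g ^+ r * V g k l.
Proof.
apply: common_denominator_mpoly => k l; exact: rep_fun_regular.
Qed.

Variables (Q : 'I_n -> 'I_n -> mpoly.mpoly (N * N) K) (r : nat).
Hypothesis VQ : forall g, g \in unitmx -> forall k l, mxeval (Q k l) g = \det g ^+ r * V g k l.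

(* In the entry [k, l], [V (1 + h X) = q h / d h ^ r] with [q] and [d] polynomials
   in [h] and [d 0 = 1]. *)
Lemma lie_action_rho X : lie_action V X = rho Q r X.
Proof.
apply: cvg_lim => //; apply: cvg_mx_entries => k l.
have [d [de d0 d1]] := mxline_expansion (det_mpoly K N) 1%:M X.
have [q [qe q0 q1]] := mxline_expansion (Q k l) 1%:M X.
have d01 : d`_0 = 1 by rewrite d0 mxeval_det det1.
have [e0 e1] := coef1_expr r d01.
set e := d ^+ r in e0 e1.
pose del : K := (k == l)%:R.
have V1 : V 1%:M k l = del by rewrite rep_fun1 mxE.
have F0 : root (q - del *: e) 0.
  rewrite /root horner_coef0 coefB coefZ e0 q0 VQ ?unitmx1 // V1.
  by rewrite det1 expr1n mul1r mulr1 subrr.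
(* V (1 + h X) - 1 has the entry (q - del e) / e, whose numerator vanishes at h = 0. Dividing out h
   gives a difference quotient G / e that is regular at 0. *)
have [G FG] := factor_theorem _ _ F0.
have -> : rho Q r X k l = G.[0] / e.[0].
  rewrite horner_coef0 [X in _ / X]horner_coef0 e0 divr1.
  have : (q - del *: e)`_1 = G`_0 by rewrite FG subr0 coefMX.
  rewrite coefB coefZ q1 e1 d1 => <-.
  by rewrite !mxE /del /det_deriv; case: (k == l); rewrite ?mulr1n ?mulr0n; ring.
have at0 : h @[h --> (0 : K)^'] --> (0 : K^o) by apply: cvg_within.
have lim : G.[h] / e.[h] @[h --> (0 : K)^'] --> (G.[0] / e.[0] : K^o).
  apply: cvgM; first exact: cvg_horner.
  by apply: cvgV; [rewrite horner_coef0 e0 oner_eq0 | exact: cvg_horner].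
apply: cvg_trans lim; apply: near_eq_cvg.
near=> h.
have h0 : h != 0 by near: h; apply: nbhs_dnbhs_neq.
have dh : d.[h] != 0.
  near: h; apply: cvgr_neq0 (@cvg_horner K _ _ d _ at0) _.
  by rewrite horner_coef0 d01 oner_eq0.
have eh : e.[h] = d.[h] ^+ r by rewrite horner_exp.
have hU : 1%:M + h *: X \in unitmx by rewrite unitmxE unitfE -mxeval_det de.
rewrite /= !mxE [h *: X + _]addrC.
have -> : V (1%:M + h *: X) k l = q.[h] / e.[h].
  by rewrite -qe VQ // eh -de mxeval_det mulrC mulKf // -mxeval_det de expf_neq0.
rewrite V1 /GRing.scale /=.
have : (q - del *: e).[h] = G.[h] * h by rewrite FG !hornerE subr0.
rewrite hornerD hornerN hornerZ => Fh; have e_neq0 : e.[h] != 0 by rewrite eh expf_neq0.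
have -> : G.[h] = (q.[h] - del * e.[h]) / h by rewrite Fh mulfK.
by field; rewrite h0 e_neq0.
Unshelve. all: by end_near.
Qed.

Variables (v : 'cV[K]_n) (lam : 'I_N -> int).
Hypothesis v_weight : forall b : 'M[K]_N, b \in unitmx -> is_trig_mx b^T ->
  V b *m v = (\prod_(i < N) b i i ^ lam i) *: v.

Lemma trig_line (i j : 'I_N) (h : K) : (i <= j)%N -> is_trig_mx (1%:M + h *: delta_mx i j)^T.
Proof.
move=> ij; apply/is_trig_mxP => a b ab; rewrite !mxE.
have -> : (b == a) = false by apply/eqP => e; rewrite e ltnn in ab.
case: (b =P i) => [bi|_]; case: (a =P j) => [aj|_]; rewrite /= ?mulr0 ?addr0 //.
by move: ab ij; rewrite -bi -aj ltnNge => /negbTE ->.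
Qed.

Lemma weight_line_poly X (c : K) (p q : {poly K}) :
  (forall h, \det (1%:M + h *: X) = 1 + h * c) ->
  (forall h, 1 + h * c != 0 -> p.[h] *: (V (1%:M + h *: X) *m v) = q.[h] *: v) ->
  p`_0 = 1 -> q`_0 = 1 ->
  deriv_mx Q X *m v = (r%:R * c + q`_1 - p`_1) *: v.
Proof.
move=> detE VE p0 q0.
pose d : {poly K} := 1 + c *: 'X.
have dE h : d.[h] = 1 + h * c by rewrite !hornerE mulrC.
have d0 : d != 0 by apply/eqP => dz; have := dE 0; rewrite dz horner0 mul0r addr0 => /esym/eqP; rewrite oner_eq0.
have d0' : d`_0 = 1 by rewrite coefD coef1 coefZ coefX mulr0 addr0.
have d1 : d`_1 = c by rewrite coefD coef1 coefZ coefX mulr1 add0r.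
have [e0 e1] := coef1_expr r d0'.
apply/matrixP => k z; rewrite (ord1 z) [LHS]mxE [RHS]mxE.
have [f fP] := fin_all_exists (fun l => mxline_expansion (Q k l) 1%:M X).
have pq : p * (\sum_l f l * (v l 0)%:P) = q * (d ^+ r * (v k 0)%:P).
  apply: (poly_eq_off d0) => h dh.
  have hU : 1%:M + h *: X \in unitmx by rewrite unitmxE unitfE detE -dE.
  have SE : (\sum_l f l * (v l 0)%:P).[h] = d.[h] ^+ r * (V (1%:M + h *: X) *m v) k 0.
    rewrite horner_sum dE -detE mxE mulr_sumr; apply: eq_bigr => l _.
    by have [fe _ _] := fP l; rewrite hornerM hornerC -fe VQ // mulrA.
  have := VE h; rewrite -dE => /(_ dh)/matrixP/(_ k 0); rewrite [LHS]mxE [RHS]mxE => E.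
  by rewrite !hornerM horner_exp hornerC SE mulrCA E mulrCA.
have f0 : (\sum_l f l * (v l 0)%:P)`_0 = v k 0.
  have fl0 l : (f l)`_0 = (k == l)%:R.
    by have [_ -> _] := fP l; rewrite VQ ?unitmx1 // det1 expr1n mul1r rep_fun1 mxE.
  rewrite coef_sum (bigD1 k) //= coefMC fl0 eqxx mul1r big1 ?addr0 // => l lk.
  by rewrite coefMC fl0 eq_sym (negPf lk) mul0r.
have f1 : (\sum_l f l * (v l 0)%:P)`_1 = \sum_l deriv_mx Q X k l * v l 0.
  by rewrite coef_sum; apply: eq_bigr => l _; rewrite coefMC mxE; have [_ _ ->] := fP l.
have coef1M (a b : {poly K}) : (a * b)`_1 = a`_0 * b`_1 + a`_1 * b`_0.
  by rewrite coefM !big_ord_recl big_ord0 /= /bump /= subn0 addr0.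
move/(congr1 (fun a : {poly K} => a`_1)): pq; rewrite !coef1M f0 f1 ?coefMC e0 e1 d1 p0 q0 !coefC /= => E.
rewrite -[LHS]mul1r -[LHS](addrK (p`_1 * v k 0)) E; ring.
Qed.

Lemma rho_upper (i j : 'I_N) : (i < j)%N -> rho Q r (delta_mx i j) *m v = 0.
Proof.
move=> ij; have ij' : (i == j) = false by apply/eqP => e; rewrite e ltnn in ij.
rewrite rho_delta ij' mulr0 raddf0 subr0.
rewrite (@weight_line_poly _ 0 1 1) ?coef1 ?mulr0 ?add0r /= ?oppr0 ?subrr ?scale0r // => h.
  by rewrite det_transvection ij'.
rewrite mulr0 addr0 => _; rewrite v_weight ?trig_line 1?ltnW //; last first.
  by rewrite unitmxE det_transvection ij' mulr0 addr0 unitr1.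
rewrite big1 ?scale1r // => a _; rewrite !mxE eqxx.
case: (a =P i) => [->|_]; rewrite ?ij' /= ?mulr0 ?addr0 ?exp1rz //.
Qed.

Lemma rho_weight (i : 'I_N) : rho Q r (delta_mx i i) *m v = (lam i)%:~R *: v.
Proof.
rewrite rho_delta eqxx mulr1 mulmxBl mul_scalar_mx.
(* Writing the weight as a difference of naturals turns the character (1 + h)^(lam i) into a
   quotient of two polynomials in h. *)
have [c [m lamE]] : exists c m : nat, lam i = c%:Z - m%:Z.
  case: (lam i) => [c|m]; first by exists c, 0%N; rewrite subr0.
  by exists 0%N, m.+1; rewrite NegzE sub0r.
have X0 : (1 + 'X : {poly K})`_0 = 1 by rewrite coefD coef1 coefX addr0.
have X1 : (1 + 'X : {poly K})`_1 = 1 by rewrite coefD coef1 coefX add0r.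
have [c0 c1] := coef1_expr c X0; have [m0 m1] := coef1_expr m X0.
rewrite (@weight_line_poly _ 1 ((1 + 'X) ^+ m) ((1 + 'X) ^+ c)) //.
- rewrite c1 m1 X1 !mulr1 -scalerBl; congr (_ *: _).
  by rewrite lamE rmorphB /= -!pmulrn; ring.
- by move=> h; rewrite det_transvection eqxx.
move=> h; rewrite mulr1 => h1; rewrite v_weight ?trig_line //; last first.
  by rewrite unitmxE det_transvection eqxx mulr1 unitfE.
rewrite (bigD1 i) //= big1 ?mulr1 => [|a /negPf ai]; last first.
  by rewrite !mxE ai eqxx mulr0 addr0 exp1rz.
rewrite !mxE !eqxx mulr1 scalerA !horner_exp !hornerE; congr (_ *: _).
rewrite lamE expfzDr //= -exprnN -exprnP mulrCA mulfV ?mulr1 //.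
by rewrite expf_neq0.
Qed.
End RationalRep.

(** * The traces of powers commute with the group *)

Section TracePowers.
Variables (K : fieldType) (N n : nat) (A : 'M['M[K]_n]_N) (U : 'M[K]_n) (g : 'M[K]_N).
Hypothesis gU : g \in unitmx.
Hypothesis U_conj : forall i j, U *m A i j = (\sum_k \sum_l (g k i * invmx g j l) *: A k l) *m U.

Let Gl : 'M['M[K]_n]_N := \matrix_(i, k) (g k i)%:M.
Let Gr : 'M['M[K]_n]_N := \matrix_(l, j) (invmx g j l)%:M.

Lemma conj_sandwich (X : 'M['M[K]_n]_N) i j :
  (Gl * X * Gr) i j = \sum_k \sum_l (g k i * invmx g j l) *: X k l.
Proof.
rewrite mxE; under eq_bigr do rewrite mxE mulr_suml.
rewrite exchange_big; apply: eq_bigr => k _; apply: eq_bigr => l _.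
rewrite !mxE; rewrite -[_ * X k l]/(_%:M *m X k l) -[_ * _%:M]/(_ *m _%:M).
by rewrite mul_mx_scalar mul_scalar_mx scalerA mulrC.
Qed.

Lemma Gr_Gl : Gr * Gl = 1.
Proof.
apply/matrixP => l k; rewrite [LHS]mxE [RHS]mxE.
transitivity ((\sum_j g k j * invmx g j l)%:M : 'M[K]_n).
  rewrite raddf_sum; apply: eq_bigr => j _; rewrite !mxE mulrC; exact: esym (scalar_mxM _ _ _).
have -> : \sum_j g k j * invmx g j l = (g *m invmx g) k l by rewrite mxE.
by rewrite mulmxV // mxE eq_sym; case: (l == k); rewrite ?raddf0.
Qed.

Lemma Gl_Gr : Gl * Gr = 1.
Proof.
apply/matrixP => i j; rewrite [LHS]mxE [RHS]mxE.
transitivity ((\sum_k invmx g j k * g k i)%:M : 'M[K]_n).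
  rewrite raddf_sum; apply: eq_bigr => k _; rewrite !mxE mulrC; exact: esym (scalar_mxM _ _ _).
have -> : \sum_k invmx g j k * g k i = (invmx g *m g) j i by rewrite mxE.
by rewrite mulVmx // mxE eq_sym; case: (i == j); rewrite ?raddf0.
Qed.

(** Moving U across A conjugates A by scalar matrices, the transposes of g and its inverse. These
    telescope in a power because Gr Gl = 1, and the trace recombines them into g g^-1. *)
Lemma trace_pow_commute p : U *m (\sum_i (A ^+ p) i i) = (\sum_i (A ^+ p) i i) *m U.
Proof.
have UE (X : 'M['M[K]_n]_N) i j : (U%:M * X) i j = U *m X i j.
  by have -> : U%:M * X = U *: X; [exact: mul_scalar_mx | rewrite mxE].
have EU (X : 'M['M[K]_n]_N) i j : (X * U%:M) i j = X i j *m U.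
  rewrite mxE (bigD1 j) //= big1 ?addr0 ?mxE ?eqxx // => k /negPf kj.
  by rewrite mxE kj mulr0.
have UA : U%:M * A = Gl * A * Gr * U%:M.
  by apply/matrixP => i j; rewrite UE EU conj_sandwich U_conj.
have UAp : U%:M * A ^+ p = Gl * A ^+ p * Gr * U%:M.
  elim: p => [|p IHp]; first by rewrite expr0 !mulr1 Gl_Gr mul1r.
  by rewrite exprS mulrA UA -!mulrA [U%:M * _]IHp !mulrA -[_ * A * Gr * Gl]mulrA Gr_Gl mulr1.
rewrite mulmx_sumr; under eq_bigr do rewrite -UE UAp EU conj_sandwich.
rewrite -mulmx_suml; congr (_ *m _).
rewrite exchange_big; apply: eq_bigr => k _ /=; rewrite exchange_big /=.
rewrite (bigD1 k) //= [X in _ + X]big1 ?addr0 => [|l lk].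
  rewrite -scaler_suml (_ : \sum_i _ = (g *m invmx g) k k); last by rewrite mxE.
  by rewrite mulmxV // mxE eqxx scale1r.
rewrite -scaler_suml (_ : \sum_i _ = (g *m invmx g) k l); last by rewrite mxE.
by rewrite mulmxV // mxE eq_sym (negPf lk) scale0r.
Qed.
End TracePowers.

(** * The matrix of a single representation: bracket, adjoint, traces *)

Section RepData.
Variables (R : realType) (n : nat) (h : R) (a : 'I_n.+1 -> R) (V : rational_rep R[i] n.+1).
Hypothesis V_rep : corresponds_to h a V.
Hypothesis a_decr : forall i j : 'I_n.+1, (i < j)%N -> a j < a i.
Local Notation e := (fun i j => lie_action V (delta_mx i j)).
Definition rep_matrix : 'M['M[R[i]]_(rep_dim V)]_n.+1 := \matrix_(i, j) (h%:C%C *: e i j).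

Lemma rep_matrixE (Q : 'I_(rep_dim V) -> 'I_(rep_dim V) -> mpoly.mpoly (n.+1 * n.+1) R[i]) r :
  (forall g, g \in unitmx -> forall k l, mxeval (Q k l) g = \det g ^+ r * V g k l) ->
  forall i j, rep_matrix i j = h%:C%C *: rho Q r (delta_mx i j).
Proof. by move=> VQ i j; rewrite [LHS]mxE (lie_action_rho VQ). Qed.

Lemma rep_dim_gt0 : (0 < rep_dim V)%N.
Proof. by have [[]] := V_rep. Qed.

Lemma rep_matrix_bracket i j k l :
  rep_matrix i j *m rep_matrix k l - rep_matrix k l *m rep_matrix i j =
  h%:C%C *: ((if j == k then rep_matrix i l else 0) - (if i == l then rep_matrix k j else 0)).
Proof.
have [[n0 Vi] _] := V_rep; have [Q [r VQ]] := common_denominator V.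
have VM := @rep_funM _ _ V; have V1 := rep_fun1 V.
have c := gl_comm V1 VM VQ n0 Vi i j k l.
rewrite !(rep_matrixE VQ); move: (rho Q r) c => f c.
rewrite -!scalemxAl -!scalemxAr -!scalerBr c; congr (_ *: _).
by rewrite scalerBr; case: (j == k); case: (i == l); rewrite ?scaler0.
Qed.

Lemma rep_unitarizable : exists2 T : 'M[R[i]]_(rep_dim V), T \in unitmx & forall i j,
  (T *m rep_matrix i j *m invmx T)^H = T *m rep_matrix j i *m invmx T.
Proof.
have [[n0 Vi] _] := V_rep; have [Q [r VQ]] := common_denominator V.
have [T TU TH] := unitarizable (rep_fun1 V) (@rep_funM _ _ V) VQ n0 Vi.
exists T => // i j; rewrite !(rep_matrixE VQ); move: (rho Q r) TH => f TH.
rewrite -!scalemxAr -!scalemxAl linearZ /= map_mxZ TH; congr (_ *: _).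
exact: conjc_real.
Qed.

Lemma rep_matrix_trace k : \sum_i (rep_matrix ^+ k) i i =
  (n.+1%:R * bpp_power_sum h k a)%:C%C%:M.
Proof.
have [[n0 Vi] [lam aE [v v0 vw]]] := V_rep; have [Q [r VQ]] := common_denominator V.
have VM := @rep_funM _ _ V; have V1 := rep_fun1 V.
have [c trE] : exists c, \sum_i (rep_matrix ^+ k) i i = c%:M.
  (* The hypothesis of [trace_pow_commute] is [rho_conj] with g E_ij g^-1 expanded in matrix units;
     its (p, q) entry is g_pi (g^-1)_jq. *)
  apply: (schur_scalar n0 Vi) => g gU; apply: trace_pow_commute (gU) _ _ => i j.
  rewrite (rep_matrixE VQ) -scalemxAr (rho_conj VM VQ) // scalemxAl; congr (_ *m _).
  rewrite rho_sum scaler_sumr; apply: eq_bigr => p _; rewrite scaler_sumr; apply: eq_bigr => q _.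
  rewrite (rep_matrixE VQ) !scalerA; congr (_ *: _); rewrite [RHS]mulrC; congr (_ * _).
  rewrite mxE (bigD1 j) //= big1 ?addr0 => [|m mj].
    rewrite [in LHS]mxE (bigD1 i) //= big1 ?addr0 ?mxE ?eqxx ?mulr1 // => m mi.
    by rewrite mxE (negPf mi) mulr0.
  by rewrite mxE big1 ?mul0r // => o _; rewrite mxE (negPf mj) andbF mulr0.
rewrite trE; congr (_%:M).
have aC i : h%:C%C * ((lam i)%:~R + (n.+1 - i.+1)%:R) = (a i)%:C%C.
  by rewrite aE /config_of_weight rmorphM /= rmorph_int rmorphD.
have a_inj : injective a.
  move=> i j aij; apply/eqP/negPn/negP => /eqP ij.
  case: (ltngtP i j) => [/a_decr|/a_decr|/ord_inj//]; rewrite aij ltxx //.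
have highest := @highest_weight_trace _ _ _ h%:C%C _ rep_matrix_bracket v (fun i => (lam i)%:~R) v0 _ _ k c trE.
rewrite highest.
- rewrite /bpp_power_sum mulrA mulfV ?pnatr_eq0 // mul1r rmorph_sum; apply: eq_bigr => i _.
  rewrite !aC rmorphM rmorphXn rmorph_prod; congr (_ * _); apply: eq_bigr => j _.
  by rewrite !aC rmorphB rmorph1 fmorph_div rmorphB.
- move=> i j ij; rewrite (rep_matrixE VQ) -scalemxAl (rho_upper VQ vw ij); exact: scaler0.
- by move=> i; rewrite (rep_matrixE VQ) -scalemxAl (rho_weight VQ vw) scalerA.
by move=> i j; rewrite !aC => /complexI/a_inj.
Qed.
End RepData.

Lemma cvg_real_complex (R : realType) (u : nat -> R) (l : R) :
  u @ \oo --> l -> (fun n => (u n)%:C%C) @ \oo --> (l%:C%C : R[i]^o).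
Proof.
move=> ul.
suff : (fun n => (u n)%:C%C : R[i]^o) @ \oo --> (l%:C%C : R[i]^o) by [].
apply/cvgrPdist_lt => e e0.
have er : e = (complex.Re e)%:C%C.
  by move: e0; case: (e) => x y; rewrite ltcE /= => /andP[/eqP -> _].
move: e0; rewrite er ltcR => e0.
move/cvgrPdist_lt : ul => /(_ _ e0); apply: filterS => n.
by rewrite -rmorphB /= normc_def /= expr0n addr0 sqrtr_sqr ltcR.
Qed.

Lemma null_of_bound (K : numFieldType) (u v : nat -> K) (c : K) :
  (forall n, `|u n| <= c * v n) -> v @ \oo --> (0 : K^o) -> u @ \oo --> (0 : K^o).
Proof.
move=> uv v0; suff : (fun n => u n : K^o) @ \oo --> (0 : K^o) by [].
apply/cvgrPdist_lt => e e0.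
have cv0 : (fun n => c * v n : K^o) @ \oo --> (0 : K^o).
  by rewrite -[X in _ --> X](mulr0 (c : K^o)); apply: cvgM => //; apply: cvg_cst.
move/cvgrPdist_lt : cv0 => /(_ _ e0); apply: filterS => n.
rewrite !sub0r !normrN; apply: le_lt_trans; apply: le_trans (uv n) _.
by rewrite ger0_norm // (le_trans _ (uv n)).
Qed.

Lemma expectation_phi (R : realType) (n : nat) (V W : rational_rep R[i] n.+1)
    (V0 : (0 < rep_dim V)%N) (W0 : (0 < rep_dim W)%N) Ta Tb
    (TaU : Ta \in unitmx) (TbU : Tb \in unitmx) (M : 'M[end_tensor V W]_n.+1) :
  bpp_expectation (amplified_trace M) =
  st_phi (mat_star_trace (tensor_trace V0 W0 TaU TbU) n) M.
Proof.
rewrite /bpp_expectation /normalized_trace /amplified_trace linearZ /= mulrCA.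
rewrite /mat_phi; congr (_ * _); rewrite raddf_sum mulr_sumr.
by apply: eq_bigr => i _.
Qed.

(** Collects what the asymptotic argument needs at a fixed N. The carrier depends on V, W and the
    chosen inner products, so the algebra and its two letters are packed into one dependent pair. *)
Lemma bpp_model (R : realType) (n : nat) (hbar : R) (a b : 'I_n.+1 -> R)
    (V W : rational_rep R[i] n.+1) :
  corresponds_to hbar a V -> corresponds_to hbar b W ->
  (forall i j : 'I_n.+1, (i < j)%N -> a j < a i) ->
  (forall i j : 'I_n.+1, (i < j)%N -> b j < b i) ->
  exists M : {S : star_trace R[i] & bool -> mat_star_trace S n},
    [/\ gl_bracket hbar%:C%C (projT2 M),
        forall c, st_star _ (projT2 M c) = projT2 M c,
        forall c k, ptr (projT2 M c ^+ k) =
          st_iota _ (bpp_power_sum hbar k (if c then a else b))%:C%C &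
        forall w, st_phi _ (word_value (projT2 M) w) =
          bpp_expectation (amplified_trace (word_value (fun c : bool =>
            if c then bpp_matrix_l hbar%:C%C V W else bpp_matrix_r hbar%:C%C V W) w))].
Proof.
move=> Va Wb a_decr b_decr.
have [Ta TaU Ta_adj] := rep_unitarizable Va.
have [Tb TbU Tb_adj] := rep_unitarizable Wb.
have p0 := rep_dim_gt0 Va; have q0 := rep_dim_gt0 Wb.
have tr_a k : \sum_i (rep_matrix hbar V ^+ k) i i = (n.+1%:R * (bpp_power_sum hbar k a)%:C%C)%:M.
  rewrite (rep_matrix_trace Va a_decr) rmorphM /=; congr ((_ * _)%:M).
  by rewrite rmorph_nat.
have tr_b k : \sum_i (rep_matrix hbar W ^+ k) i i = (n.+1%:R * (bpp_power_sum hbar k b)%:C%C)%:M.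
  rewrite (rep_matrix_trace Wb b_decr) rmorphM /=; congr ((_ * _)%:M).
  by rewrite rmorph_nat.
pose S := tensor_trace p0 q0 TaU TbU.
pose X : bool -> mat_star_trace S n := tensor_letter p0 q0 (rep_matrix hbar V) (rep_matrix hbar W) TaU TbU.
exists (existT _ S X); split=> /=.
- exact: tensor_bracket (rep_matrix_bracket Va) (rep_matrix_bracket Wb).
- by move=> c; exact: tensor_letter_star.
- by move=> c k; rewrite (tensor_letter_pure _ _ _ _ tr_a tr_b); case: c.
move=> w; rewrite (expectation_phi p0 q0 TaU TbU).
apply: (congr1 (st_phi (mat_star_trace S n))).
apply: eq_bigr => c _; apply/matrixP => i j.
by case: c; rewrite [LHS]mxE [RHS]mxE; congr (_ *t _); rewrite mxE.
Qed.

Theorem theorem1p3 (R : realType)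
    (hbar : nat -> R)
    (hbar_gt0 : forall N : nat, (0 < N)%N -> 0 < hbar N)
    (hbar_o1 : hbar @ \oo --> (0 : R))
    (a b : forall N : nat, 'I_N -> R)
    (a_lattice : forall N : nat, (0 < N)%N -> forall i : 'I_N,
       exists z : int, a N i = hbar N * z%:~R)
    (b_lattice : forall N : nat, (0 < N)%N -> forall i : 'I_N,
       exists z : int, b N i = hbar N * z%:~R)
    (a_decr : forall N : nat, (0 < N)%N -> forall i j : 'I_N,
       (i < j)%N -> a N j < a N i)
    (b_decr : forall N : nat, (0 < N)%N -> forall i j : 'I_N,
       (i < j)%N -> b N j < b N i)
    (V W : forall N : nat, rational_rep R[i] N)
    (V_rep : forall N : nat, (0 < N)%N -> corresponds_to (hbar N) (a N) (V N))
    (W_rep : forall N : nat, (0 < N)%N -> corresponds_to (hbar N) (b N) (W N))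
    (s t : nat -> R)
    (s_lim : forall k : nat, (0 < k)%N ->
       (fun N : nat => bpp_power_sum (hbar N) k (a N)) @ \oo --> s k)
    (t_lim : forall k : nat, (0 < k)%N ->
       (fun N : nat => bpp_power_sum (hbar N) k (b N)) @ \oo --> t k)
    (AA : algType R[i]) (tau : {scalar AA}) (A B : AA)
    (tau_tracial : tracial_state tau)
    (AB_free : freely_independent tau A B)
    (A_moments : forall k : nat, (0 < k)%N -> tau (A ^+ k) = (s k)%:C%C)
    (B_moments : forall k : nat, (0 < k)%N -> tau (B ^+ k) = (t k)%:C%C)
    (d : nat) (d_gt0 : (0 < d)%N) (p q : 'I_d -> nat) :
  (fun N : nat =>
     let A_N := bpp_matrix_l (hbar N)%:C%C (V N) (W N) in
     let B_N := bpp_matrix_r (hbar N)%:C%C (V N) (W N) in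
     bpp_expectation (amplified_trace
       (\prod_(r < d) (A_N ^+ p r * B_N ^+ q r)) : end_tensor (V N) (W N)))
    @ \oo --> (tau (\prod_(r < d) (A ^+ p r * B ^+ q r)) : R[i]^o).
Proof.
(* The index n stands for N = n + 1, which keeps matrix sizes positive; limits are transported by
   [cvg_shiftS]. The models are picked by choice, one for each n. *)
pose S_X := fun n => bpp_model (V_rep n.+1 isT) (W_rep n.+1 isT) (a_decr n.+1 isT) (b_decr n.+1 isT).
pose f n := sval (cid (S_X n)); have fP n := svalP (cid (S_X n)).
pose S n := projT1 (f n); pose X n : bool -> mat_star_trace (S n) n := projT2 (f n).
pose m n (c : bool) k : R[i] := (bpp_power_sum (hbar n.+1) k (if c then a n.+1 else b n.+1))%:C%C.
pose h n : R[i] := (hbar n.+1)%:C%C.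
have h_gt0 n : 0 < h n by rewrite ltcR hbar_gt0.
have X_bracket n : gl_bracket (h n) (X n) by have [] := fP n.
have X_star n c : st_star (mat_star_trace (S n) n) (X n c) = X n c by have [_ + _ _] := fP n; apply.
have X_pure n c k : ptr (X n c ^+ k) = st_iota (S n) (m n c k) by have [_ _ + _] := fP n; apply.
have m_lim c k : (0 < k)%N ->
    (fun n => bpp_power_sum (hbar n.+1) k (if c then a n.+1 else b n.+1)) @ \oo --> (if c then s k else t k).
  by move=> k0; case: c; [move: (s_lim k k0) | move: (t_lim k k0)]; rewrite -cvg_shiftS.
have m_bounded c k : (0 < k)%N -> exists M, forall n, m n c k <= M.
  move=> k0; have [M [_ HM]] := cvg_seq_bounded (cvgP _ (m_lim c k k0)).
  exists (M + 1)%:C%C => n; rewrite lecR; apply: le_trans (ler_norm _) _.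
  by apply: HM => //; rewrite ltrDl.
pose F n Ws := joint_moment X n Ws.
pose tau_w := free_moment tau A B.
have tau1 : tau 1 = 1 by have [] := tau_tracial.
have h0 : h @ \oo --> (0 : R[i]^o).
  by apply: (@cvg_real_complex _ _ 0); move: hbar_o1; rewrite -cvg_shiftS.
(* The limits are given for k > 0 only; the power sum of order 0 is read off from the trace of the
   identity. *)
have m0 n c : m n c 0%N = 1.
  have := X_pure n c 0%N; rewrite expr0 => /(congr1 (st_phi (S n))).
  by rewrite phi_ptr phi1 -[st_iota _ _]mulr1 phi_iota phi1 mulr1.
have tau_nil : tau_w [::] = 1 by rewrite /tau_w /free_moment /word_value big_nil.
have tau_pure c k : (0 < k)%N -> tau_w (nseq k c) = (if c then s k else t k)%:C%C.
  by move=> k0; rewrite /tau_w /free_moment word_value_nseq; case: c; [apply: A_moments | apply: B_moments].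
have F_nil n : F n [::] = 1 by exact: joint_moment_nil.
have F_pure n c k Ws : F n (nseq k c :: Ws) = m n c k * F n Ws by exact: joint_moment_pure.
have m_cvg c k : (fun n => m n c k) @ \oo --> (tau_w (nseq k c) : R[i]^o).
  case: k => [|k]; last first.
    by rewrite (tau_pure c k.+1 isT); apply: cvg_real_complex; exact: m_lim.
  have -> : (fun n => m n c 0%N) = cst 1 by apply/funext => n; rewrite m0.
  by rewrite tau_nil; exact: (@cvg_cst R[i]^o).
have F_cyclic v w Ws :
    (fun n => F n ((v ++ w) :: Ws) - F n ((w ++ v) :: Ws)) @ \oo --> (0 : R[i]^o).
  have [M HM] := joint_moment_cyclic h_gt0 X_bracket X_star X_pure m_bounded v w Ws.
  exact: null_of_bound HM h0.
have tau_cyclic v w : tau_w (v ++ w) = tau_w (w ++ v).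
  by rewrite /tau_w /free_moment !word_value_cat; have [_ ->] := tau_tracial.
have F_loop w Ws : (fun n => \sum_(0 <= s < size w | nth false w s)
     (F n [:: take s w, drop s w & Ws] - F n [:: take s.+1 w, drop s.+1 w & Ws]))
    @ \oo --> (0 : R[i]^o).
  have [M HM] := joint_moment_loop h_gt0 X_bracket X_star X_pure m_bounded w Ws.
  apply: null_of_bound HM _.
  rewrite (_ : (fun n => n.+1%:R^-1) = (fun n => (harmonic n : R)%:C%C)).
    exact: (@cvg_real_complex _ _ 0) cvg_harmonic.
  by apply/funext => n; rewrite /= fmorphV rmorph_nat.
have tau_loop := free_moment_loop tau1 AB_free.
have conv := joint_moments_null F_nil m0 tau_nil F_pure m_cvg F_cyclic tau_cyclic F_loop tau_loop.
pose w := flatten [seq nseq (p r) true ++ nseq (q r) false | r <- index_enum 'I_d].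
have wE (T : pzRingType) (Y : bool -> T) : word_value Y w = \prod_(r < d) (Y true ^+ p r * Y false ^+ q r).
  rewrite /w /word_value big_flatten big_map; apply: eq_bigr => r _.
  by rewrite -/(word_value _ _) word_value_cat !word_value_nseq.
have Fw : (fun n => F n [:: w]) @ \oo --> (tau (\prod_(r < d) (A ^+ p r * B ^+ q r)) : R[i]^o).
  rewrite (_ : (fun n => F n [:: w]) = (fun n => (F n [:: w] - \prod_(u <- [:: w]) tau_w u) + tau_w w)).
    rewrite -(wE _ (fun c => if c then A else B)) -[X in _ --> X]add0r.
    by apply: cvgD; [exact: conv | exact: cvg_cst].
  by apply/funext => n; rewrite big_seq1 subrK.
set E := fun N : nat => _; rewrite -(@cvg_shiftS R[i]^o E).
suff -> : (fun n => E n.+1) = (fun n => F n [:: w]) by exact: Fw.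
apply/funext => n; have [_ _ _ fw] := fP n.
by rewrite /F /joint_moment big_seq1 phi_ptr fw wE.
Qed.
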